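(* For any integer $\alpha\ge 1$ and any $F_t(z)\in\mathbb A_t^{[\alpha]}\langle\langle z\rangle\rangle$, the $5$-tuple $$\Omega_{F_t}:=(f(t),\,g(t),\,d(t),\,h(t),\,m(t))\in \mathcal D^{[\alpha]}\langle\langle z\rangle\rangle[[t]]^{\times 5}$$ associated with $F_t$ forms an $\mathcal N$CS system over the $K$-algebra $\mathcal D^{[\alpha]}\langle\langle z\rangle\rangle$; that is, $f(0)=1$, $f(-t)g(t)=g(t)f(-t)=1$, $e^{d(t)}=g(t)$, $\frac{d g(t)}{dt}=g(t)h(t)$ and $\frac{d g(t)}{dt}=m(t)g(t)$.
   Context: Setup. $K$ is a unital commutative $\mathbb Q$-algebra, $z=(z_1,\dots,z_n)$ ($n\ge 1$) are independent variables, either commutative or noncommutative (free); statements hold in both cases and the same notation is used for both. $t$ is a formal parameter commuting with everything. $K\langle\langle z\rangle\rangle$ and $K[[t]]\langle\langle z\rangle\rangle$ are the formal power series algebras in $z$ over $K$ and $K[[t]]$. $o(u)$ is the lowest degree in $z$ of the monomials occurring in $u$ (for a vector, the minimum over its components). For $\vec u=(u_1,\dots,u_n)$ a vector of power series, $[\vec u\,\frac{\partial}{\partial z}]$ is the unique derivation (over $K$, resp. $K[[t]]$) sending $z_i$ to $u_i$ for each $i$; every derivation is of this form. $\mathcal Der^{[\alpha]}\langle\langle z\rangle\rangle$ is the set of $K$-derivations of $K\langle\langle z\rangle\rangle$ that increase the degree in $z$ by at least $\alpha-1$ (i.e. $[\vec u\frac{\partial}{\partial z}]$ with $o(\vec u)\ge\alpha$),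 and $\mathcal D^{[\alpha]}\langle\langle z\rangle\rangle$ is the unital subalgebra of $\mathrm{End}_K(K\langle\langle z\rangle\rangle)$ generated by $\mathcal Der^{[\alpha]}\langle\langle z\rangle\rangle$. Elements of $\mathcal D^{[\alpha]}\langle\langle z\rangle\rangle[[t]]$ act $K[[t]]$-linearly on $K[[t]]\langle\langle z\rangle\rangle$ in the obvious way. $\mathbb A_t^{[\alpha]}\langle\langle z\rangle\rangle$ is the set of automorphisms $F_t(z)=z-H_t(z)$ of $K[[t]]\langle\langle z\rangle\rangle$ over $K[[t]]$ with $H_t(z)\in K[[t]]\langle\langle z\rangle\rangle^{\times n}$, $o(H_t(z))\ge\alpha$ and $H_{t=0}(z)=0$. The inverse map is written $G_t(z)=F_t^{-1}(z)=z+M_t(z)$; then $o(M_t)\ge\alpha$ and $M_{t=0}=0$. $u(F_t)$ denotes substitution of $F_t(z)$ for $z$ in $u$. The 5-tuple $\Omega_{F_t}$. $f(t)=\sum_{m\ge0}t^m\lambda_m$ and $g(t)=\sum_{m\ge0}t^m s_m$, where $\lambda_m,s_m\in\mathcal D^{[\alpha]}\langle\langle z\rangle\rangle$ are the unique sequences with $\lambda_0=s_0=1$ such that $f(-t)u_t(z)=u_t(F_t)$ and $g(t)u_t(z)=u_t(G_t)$ for all $u_t(z)\in K[[t]]\langle\langle z\rangle\rangle$. $d(t)=\sum_{m\ge1}\frac{t^m}{m}\phi_m:=-[a_t(z)\frac{\partial}{\partial z}]$, where $a_t(z)\in K[[t]]\langle\langle z\rangle\rangle^{\times n}$ (the D-Log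 of $F_t$) is the unique vector with $a_{t=0}(z)=0$, $o(a_t(z))\ge\alpha$ and $e^{[a_t(z)\frac{\partial}{\partial z}]}\cdot z=F_t(z)$. $h(t)=\sum_{m\ge1}\psi_m t^{m-1}:=[\frac{\partial M_t}{\partial t}(F_t)\frac{\partial}{\partial z}]$ and $m(t)=\sum_{m\ge1}\xi_m t^{m-1}:=[\frac{\partial H_t}{\partial t}(G_t)\frac{\partial}{\partial z}]$. $\mathcal N$CS system. For a unital associative $K$-algebra $A$, a $5$-tuple $(f(t),g(t),d(t),h(t),m(t))\in A[[t]]^{\times5}$ is an $\mathcal N$CS (noncommutative symmetric) system over $A$ if $f(0)=1$; $f(-t)g(t)=g(t)f(-t)=1$; $e^{d(t)}=g(t)$; $\frac{dg(t)}{dt}=g(t)h(t)$; $\frac{dg(t)}{dt}=m(t)g(t)$. *)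

(* Defs.v *)
From HB Require Import structures.
From mathcomp Require Import all_boot all_order all_algebra.
From mathcomp Require Import boolp.
From mathcomp Require Import mpoly.

Set Implicit Arguments.
Unset Strict Implicit.
Unset Printing Implicit Defensive.
Import GRing.Theory.
Local Open Scope ring_scope.

(* The monomials in n variables: either the words over 'I_n or the
   multi-indices.  [mword m] writes m as an ordered product of variables and
   [mbelow d] lists the finitely many monomials of degree at most d. *)
Record monomials (n : nat) := Monomials {
  mon :> choiceType;
  mone : mon;
  mmul : mon -> mon -> mon;
  mvar : 'I_n -> mon;
  mword : mon -> seq 'I_n;
  mbelow : nat -> seq mon;
  mmulA : associative mmul;
  mmul1m : left_id mone mmul;
  mmulm1 : right_id mone mmul;
  mword_prod : forall m, foldr (fun i => mmul (mvar i)) mone (mword m) = m;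
  size_mwordM : forall a b,
    size (mword (mmul a b)) = (size (mword a) + size (mword b))%N;
  size_mword_var : forall i, size (mword (mvar i)) = 1%N;
  mbelow_uniq : forall d, uniq (mbelow d);
  mem_mbelow : forall d m, (m \in mbelow d) = (size (mword m) <= d)%N
}.
Arguments mone {n _}.
Arguments mmul {n _}.
Arguments mvar {n _}.
Arguments mword {n _}.

Definition degree n (M : monomials n) (m : M) : nat := size (mword m).

Section FreeMonomials.
Variable n : nat.

Definition words_below d : seq (seq 'I_n) :=
  flatten [seq [seq val t | t <- enum {: k.-tuple 'I_n}] | k <- iota 0 d.+1].

Lemma mem_words_below d w : (w \in words_below d) = (size w <= d)%N.
Proof.
apply/flatten_mapP/idP => [[k]|le_wd].
  by rewrite mem_iota => /= lt_kd /mapP[t _ ->]; rewrite size_tuple.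
exists (size w); first by rewrite mem_iota.
by apply/mapP; exists (in_tuple w); rewrite ?mem_enum.
Qed.

Lemma words_below_uniq d : uniq (words_below d).
Proof.
rewrite /words_below; elim: d => [|d IHd].
  by rewrite /= cats0 map_inj_uniq ?enum_uniq //; apply: val_inj.
rewrite -addn1 iotaD map_cat flatten_cat cat_uniq IHd /= cats0.
rewrite map_inj_uniq ?enum_uniq ?andbT; last exact: val_inj.
apply/hasPn => _ /mapP[t _ ->].
by rewrite -/(words_below d) mem_words_below size_tuple add0n ltnn.
Qed.

Lemma foldr_word (w : seq 'I_n) : foldr (fun i => cat [:: i]) [::] w = w.
Proof. by elim: w => //= i w ->. Qed.

Definition free_monomials : monomials n :=
  @Monomials n (seq 'I_n) [::] cat (fun i => [:: i]) id words_below
    (@catA _) (@cat0s _) (@cats0 _) foldr_word (@size_cat _)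
    (fun=> erefl) words_below_uniq mem_words_below.

End FreeMonomials.

Section CommutativeMonomials.
Variable n : nat.

Definition multinom_word (m : 'X_{1..n}) : seq 'I_n :=
  flatten [seq nseq (m i) i | i <- enum 'I_n].

Definition multinoms_below d : seq 'X_{1..n} :=
  [seq bmnm m | m <- enum {: 'X_{1..n < d.+1}}].

Lemma size_multinom_word m : size (multinom_word m) = mdeg m.
Proof.
rewrite size_flatten /shape -map_comp mdegE sumnE big_map big_enum.
by apply: eq_bigr => i _ /=; rewrite size_nseq.
Qed.

Lemma multinom_word_prod m :
  foldr (fun i => mnm_add (mnm1 i)) mnm0 (multinom_word m) = m.
Proof.
have foldrE w : foldr (fun i => mnm_add (mnm1 i)) (@mnm0 n) w
    = (\sum_(i <- w) U_(i))%MM.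
  by elim: w => [|i w IHw]; rewrite ?big_nil // big_cons /= IHw.
rewrite foldrE big_flatten big_map big_enum /=.
rewrite [RHS]multinomUE_id; apply: eq_bigr => i _.
by elim: (m i) => [|k IHk]; rewrite ?big_nil // big_cons IHk mulmS.
Qed.

Lemma mem_multinoms_below d m :
  (m \in multinoms_below d) = (size (multinom_word m) <= d)%N.
Proof.
rewrite size_multinom_word; apply/mapP/idP => [[b _ ->]|le_md].
  by rewrite -ltnS bmdeg.
by exists (BMultinom (le_md : mdeg m < d.+1)%N); rewrite ?mem_enum.
Qed.

Lemma multinoms_below_uniq d : uniq (multinoms_below d).
Proof. by rewrite map_inj_uniq ?enum_uniq //; apply: val_inj. Qed.

Lemma size_multinom_wordM (a b : 'X_{1..n}) : size (multinom_word (a + b)%MM)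
  = (size (multinom_word a) + size (multinom_word b))%N.
Proof. by rewrite !size_multinom_word mdegD. Qed.

Lemma size_multinom_word_var i : size (multinom_word U_(i)%MM) = 1%N.
Proof. by rewrite size_multinom_word mdeg1. Qed.

Definition commutative_monomials : monomials n :=
  @Monomials n 'X_{1..n} mnm0 (@mnm_add n) (@mnm1 n) multinom_word
    multinoms_below (@addmA n) (@add0m n) (@addm0 n) multinom_word_prod
    size_multinom_wordM size_multinom_word_var multinoms_below_uniq
    mem_multinoms_below.

End CommutativeMonomials.

Section PowersOfT.

Lemma foldr_power m : foldr (fun=> addn 1) 0%N (nseq m (@ord0 0)) = m.
Proof. by elim: m => //= m ->. Qed.

Lemma size_power_add a b : size (nseq (a + b) (@ord0 0))
  = (size (nseq a (@ord0 0)) + size (nseq b (@ord0 0)))%N.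
Proof. by rewrite !size_nseq. Qed.

Lemma mem_powers_below d m : (m \in iota 0 d.+1) = (size (nseq m (@ord0 0)) <= d)%N.
Proof. by rewrite mem_iota size_nseq. Qed.

(* t ^ m is represented by its exponent m. *)
Definition powers_of_t : monomials 1 :=
  @Monomials 1 nat 0%N addn (fun=> 1%N) (nseq^~ ord0)
    (fun d => iota 0 d.+1) addnA add0n addn0 foldr_power size_power_add
    (fun=> erefl) (fun d => iota_uniq 0 d.+1) mem_powers_below.

End PowersOfT.

Inductive variables := Commutative | Free.

Definition monomials_in (v : variables) (n : nat) : monomials n :=
  match v with
  | Commutative => commutative_monomials n
  | Free => free_monomials n
  end.

Record series n (M : monomials n) (R : Type) := Series { coef : M -> R }.

Lemma seriesP n (M : monomials n) R (u v : series M R) :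
  coef u =1 coef v -> u = v.
Proof. by case: u v => [u] [v] /= /funext ->. Qed.

HB.instance Definition _ n (M : monomials n) R := gen_eqMixin (series M R).
HB.instance Definition _ n (M : monomials n) R := gen_choiceMixin (series M R).

Section SeriesZmodule.
Variables (n : nat) (M : monomials n) (R : zmodType).
Implicit Types u v w : series M R.

Definition series0 : series M R := Series (fun=> 0).
Definition series_opp u : series M R := Series (fun m => - coef u m).
Definition series_add u v : series M R := Series (fun m => coef u m + coef v m).

Lemma series_addA : associative series_add.
Proof. by move=> u v w; apply/seriesP => m /=; rewrite addrA. Qed.
Lemma series_addC : commutative series_add.
Proof. by move=> u v; apply/seriesP => m /=; rewrite addrC. Qed.
Lemma series_add0 : left_id series0 series_add.
Proof. by move=> u; apply/seriesP => m /=; rewrite add0r. Qed.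
Lemma series_addN : left_inverse series0 series_opp series_add.
Proof. by move=> u; apply/seriesP => m /=; rewrite addNr. Qed.

HB.instance Definition _ := GRing.isZmodule.Build (series M R)
  series_addA series_addC series_add0 series_addN.

End SeriesZmodule.

Section SeriesRing.
Variables (n : nat) (M : monomials n) (R : nzRingType).
Implicit Types u v w : series M R.

Definition monomial (m : M) : series M R := Series (fun m' => (m' == m)%:R).
Definition variable (i : 'I_n) : series M R := monomial (mvar i).

Definition series_mul u v : series M R := Series (fun m =>
  \sum_(a <- mbelow M (degree m))
    \sum_(b <- mbelow M (degree m) | mmul a b == m) coef u a * coef v b).

Definition series_scale (c : R) u : series M R := Series (fun m => c * coef u m).

Lemma degreeM (a b : M) : degree (mmul a b) = (degree a + degree b)%N.
Proof. exact: size_mwordM. Qed.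

Lemma sum_below_widen d e (F : M -> R) : (d <= e)%N ->
  (forall m, (d < degree m)%N -> F m = 0) ->
  \sum_(m <- mbelow M e) F m = \sum_(m <- mbelow M d) F m.
Proof.
move=> le_de F0; rewrite (bigID (fun m => degree m <= d)%N) /=.
rewrite [X in _ + X]big1 ?addr0; last by move=> m; rewrite -ltnNge => /F0.
rewrite -big_filter; apply: perm_big; apply: uniq_perm.
- exact/filter_uniq/mbelow_uniq.
- exact: mbelow_uniq.
move=> m; rewrite mem_filter !mem_mbelow -/(degree m).
by case: leqP => //= /leq_trans ->.
Qed.

Lemma sum_below_pick d (x : M) (F : M -> R) : ((d < degree x)%N -> F x = 0) ->
  \sum_(m <- mbelow M d) F m *+ (x == m) = F x.
Proof.
move=> F0; case: (leqP (degree x) d) => [le_xd | /F0 Fx0].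
  rewrite (bigD1_seq x) ?mbelow_uniq ?mem_mbelow //= eqxx big1 ?addr0 //.
  by move=> m; rewrite eq_sym => /negPf ->.
rewrite big1 ?Fx0 // => m _.
by case: eqVneq => [<-|]; rewrite ?Fx0.
Qed.

Lemma coef_mul d u v m : (degree m <= d)%N ->
  coef (series_mul u v) m = \sum_(a <- mbelow M d) \sum_(b <- mbelow M d)
    coef u a * coef v b *+ (mmul a b == m).
Proof.
move=> le_md; have big0 a b : (degree m < degree a + degree b)%N ->
    coef u a * coef v b *+ (mmul a b == m) = 0.
  by rewrite -degreeM; case: eqP => [->|]; rewrite ?ltnn.
rewrite (sum_below_widen le_md); last first.
  by move=> a lt_ma; rewrite big1 // => b _; rewrite big0 ?ltn_addr.
apply: eq_bigr => a _; rewrite (sum_below_widen le_md); last first.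
  by move=> b lt_mb; rewrite big0 ?ltn_addl.
by rewrite big_mkcond; apply: eq_bigr => b _; case: eqP.
Qed.

Lemma series_mulA : associative series_mul.
Proof.
move=> u v w; apply/seriesP => m; pose d := degree m.
rewrite !(@coef_mul d) //; transitivity (\sum_(a <- mbelow M d)
    \sum_(b <- mbelow M d) \sum_(c <- mbelow M d)
      coef u a * coef v b * coef w c *+ (mmul a (mmul b c) == m)).
  apply: eq_big_seq => a _.
  transitivity (\sum_(e <- mbelow M d) \sum_(b <- mbelow M d)
      \sum_(c <- mbelow M d) coef u a * coef v b * coef w c
        *+ (mmul a e == m) *+ (mmul b c == e)).
    apply: eq_big_seq => e; rewrite mem_mbelow => le_ed.
    rewrite (coef_mul _ _ le_ed) mulr_sumr -sumrMnl; apply: eq_bigr => b _.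
    rewrite mulr_sumr -sumrMnl; apply: eq_bigr => c _.
    by rewrite mulrnAr mulrA -!mulrnA mulnC.
  rewrite exchange_big; apply: eq_bigr => b _ /=.
  rewrite exchange_big; apply: eq_bigr => c _ /=.
  rewrite (sum_below_pick (F := fun e => _ *+ (mmul a e == m))) //.
  by case: eqP => // m_eq; rewrite /d -m_eq degreeM ltnNge leq_addl.
symmetry; transitivity (\sum_(e <- mbelow M d) \sum_(c <- mbelow M d)
   \sum_(a <- mbelow M d) \sum_(b <- mbelow M d) coef u a * coef v b * coef w c
        *+ (mmul e c == m) *+ (mmul a b == e)).
  apply: eq_big_seq => e; rewrite mem_mbelow => le_ed.
  apply: eq_bigr => c _; rewrite (coef_mul _ _ le_ed).
  rewrite mulr_suml -sumrMnl; apply: eq_bigr => a _.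
  rewrite mulr_suml -sumrMnl; apply: eq_bigr => b _.
  by rewrite mulrnAl -!mulrnA mulnC.
rewrite exchange_big /=.
under eq_bigr => c _ do rewrite exchange_big /=.
rewrite exchange_big; apply: eq_bigr => a _ /=.
under eq_bigr => c _ do rewrite exchange_big /=.
rewrite exchange_big; apply: eq_bigr => b _ /=.
apply: eq_bigr => c _; rewrite mmulA.
rewrite (sum_below_pick (F := fun e => _ *+ (mmul e c == m))) //.
by case: eqP => // m_eq; rewrite /d -m_eq degreeM ltnNge leq_addr.
Qed.

Lemma series_mul1 : left_id (monomial mone) series_mul.
Proof.
move=> u; apply/seriesP => m; rewrite (coef_mul _ _ (leqnn _)).
transitivity (\sum_(a <- mbelow M (degree m)) (\sum_(b <- mbelow M (degree m))
    coef u b *+ (mmul a b == m)) *+ (mone == a)).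
  apply: eq_bigr => a _; rewrite -sumrMnl; apply: eq_bigr => b _ /=.
  by rewrite mulr_natl (eq_sym a) mulrnAC.
rewrite sum_below_pick => [|lt_m]; last first.
  rewrite big1 // => b _; case: eqP => // m_eq.
  by move: lt_m; rewrite -m_eq degreeM ltnNge leq_addr.
under eq_bigr => b _ do rewrite mmul1m (eq_sym b).
by rewrite sum_below_pick ?ltnn.
Qed.

Lemma series_mulr1 : right_id (monomial mone) series_mul.
Proof.
move=> u; apply/seriesP => m; rewrite (coef_mul _ _ (leqnn _)) exchange_big /=.
transitivity (\sum_(b <- mbelow M (degree m)) (\sum_(a <- mbelow M (degree m))
    coef u a *+ (mmul a b == m)) *+ (mone == b)).
  apply: eq_bigr => b _; rewrite -sumrMnl; apply: eq_bigr => a _ /=.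
  by rewrite mulr_natr (eq_sym b) mulrnAC.
rewrite sum_below_pick => [|lt_m]; last first.
  rewrite big1 // => b _; case: eqP => // m_eq.
  by move: lt_m; rewrite -m_eq degreeM ltnNge leq_addl.
under eq_bigr => b _ do rewrite mmulm1 (eq_sym b).
by rewrite sum_below_pick ?ltnn.
Qed.

Lemma series_mulDl : left_distributive series_mul +%R.
Proof.
move=> u v w; apply/seriesP => m /=; rewrite -big_split; apply: eq_bigr => a _.
by rewrite -big_split; apply: eq_bigr => b _; rewrite mulrDl.
Qed.

Lemma series_mulDr : right_distributive series_mul +%R.
Proof.
move=> u v w; apply/seriesP => m /=; rewrite -big_split; apply: eq_bigr => a _.
by rewrite -big_split; apply: eq_bigr => b _; rewrite mulrDr.
Qed.

Lemma series_1neq0 : monomial mone != 0.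
Proof.
apply/eqP => /(congr1 (fun u => coef u mone)) /eqP /=.
by rewrite eqxx oner_eq0.
Qed.

HB.instance Definition _ := GRing.Zmodule_isNzRing.Build (series M R)
  series_mulA series_mul1 series_mulr1 series_mulDl series_mulDr series_1neq0.

Lemma series_scaleA a b u :
  series_scale a (series_scale b u) = series_scale (a * b) u.
Proof. by apply/seriesP => m /=; rewrite mulrA. Qed.
Lemma series_scale1 : left_id 1 series_scale.
Proof. by move=> u; apply/seriesP => m /=; rewrite mul1r. Qed.
Lemma series_scaleDr : right_distributive series_scale +%R.
Proof. by move=> a u v; apply/seriesP => m /=; rewrite mulrDr. Qed.
Lemma series_scaleDl u : {morph series_scale^~ u : a b / a + b}.
Proof. by move=> a b; apply/seriesP => m /=; rewrite mulrDl. Qed.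

HB.instance Definition _ := GRing.Zmodule_isLmodule.Build R (series M R)
  series_scaleA series_scale1 series_scaleDr series_scaleDl.

Lemma series_scaleAl a u v : a *: (u * v) = (a *: u) * v.
Proof.
apply/seriesP => m /=; rewrite mulr_sumr; apply: eq_bigr => b _.
by rewrite mulr_sumr; apply: eq_bigr => c _; rewrite mulrA.
Qed.

HB.instance Definition _ :=
  GRing.Lmodule_isLalgebra.Build R (series M R) series_scaleAl.

End SeriesRing.
Arguments monomial {n M R} m.
Arguments variable {n M R} i.

Section Endomorphisms.
Variables (K : comNzRingType) (B : lalgType K).

Definition endomorphism : Type := {linear B -> B}.
Implicit Types f g h : endomorphism.

Lemma endomorphismP f g : f =1 g -> f = g.
Proof.
case: f g => [f cf] [g cg] /= /funext eq_fg; case: _ / eq_fg in cg *.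
case: cf cg => [[f1] [f2]] [[g1] [g2]].
by rewrite (Prop_irrelevance f1 g1) (Prop_irrelevance f2 g2).
Qed.

HB.instance Definition _ := gen_eqMixin endomorphism.
HB.instance Definition _ := gen_choiceMixin endomorphism.

Definition endo0 : endomorphism := \0.
Definition endo_opp f : endomorphism := \- f.
Definition endo_add f g : endomorphism := f \+ g.
Definition endo1 : endomorphism := idfun.
Definition endo_comp f g : endomorphism := f \o g.
Definition endo_scale (c : K) f : endomorphism := c \*: f.

Lemma endo_addA : associative endo_add.
Proof. by move=> f g h; apply/endomorphismP => u /=; rewrite addrA. Qed.
Lemma endo_addC : commutative endo_add.
Proof. by move=> f g; apply/endomorphismP => u /=; rewrite addrC. Qed.
Lemma endo_add0 : left_id endo0 endo_add.
Proof. by move=> f; apply/endomorphismP => u /=; rewrite add0r. Qed.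
Lemma endo_addN : left_inverse endo0 endo_opp endo_add.
Proof. by move=> f; apply/endomorphismP => u /=; rewrite addNr. Qed.

HB.instance Definition _ := GRing.isZmodule.Build endomorphism
  endo_addA endo_addC endo_add0 endo_addN.

Lemma endo_compA : associative endo_comp.
Proof. by move=> f g h; apply/endomorphismP. Qed.
Lemma endo_comp1 : left_id endo1 endo_comp.
Proof. by move=> f; apply/endomorphismP. Qed.
Lemma endo_compr1 : right_id endo1 endo_comp.
Proof. by move=> f; apply/endomorphismP. Qed.
Lemma endo_compDl : left_distributive endo_comp +%R.
Proof. by move=> f g h; apply/endomorphismP. Qed.
Lemma endo_compDr : right_distributive endo_comp +%R.
Proof. by move=> f g h; apply/endomorphismP => u /=; rewrite linearD. Qed.
Lemma endo_1neq0 : endo1 != 0.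
Proof.
by apply/eqP => /(congr1 (fun f : endomorphism => f 1)) /eqP; rewrite /= oner_eq0.
Qed.

HB.instance Definition _ := GRing.Zmodule_isNzRing.Build endomorphism
  endo_compA endo_comp1 endo_compr1 endo_compDl endo_compDr endo_1neq0.

Lemma endo_scaleA a b f : endo_scale a (endo_scale b f) = endo_scale (a * b) f.
Proof. by apply/endomorphismP => u /=; rewrite scalerA. Qed.
Lemma endo_scale1 : left_id 1 endo_scale.
Proof. by move=> f; apply/endomorphismP => u /=; rewrite scale1r. Qed.
Lemma endo_scaleDr : right_distributive endo_scale +%R.
Proof. by move=> a f g; apply/endomorphismP => u /=; rewrite scalerDr. Qed.
Lemma endo_scaleDl f : {morph endo_scale^~ f : a b / a + b}.
Proof. by move=> a b; apply/endomorphismP => u /=; rewrite scalerDl. Qed.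

HB.instance Definition _ := GRing.Zmodule_isLmodule.Build K endomorphism
  endo_scaleA endo_scale1 endo_scaleDr endo_scaleDl.

Lemma endo_scaleAl a f g : a *: (f * g) = (a *: f) * g.
Proof. exact/endomorphismP. Qed.

HB.instance Definition _ :=
  GRing.Lmodule_isLalgebra.Build K endomorphism endo_scaleAl.

Lemma endo_scaleAr a f g : a *: (f * g) = f * (a *: g).
Proof. by apply/endomorphismP => u /=; rewrite linearZ. Qed.

HB.instance Definition _ :=
  GRing.Lalgebra_isAlgebra.Build K endomorphism endo_scaleAr.

End Endomorphisms.

Section GeneratedSubalgebra.
Variables (K : nzRingType) (A : algType K) (S : A -> Prop).

Definition generated : {pred A} := fun x =>
  `[< forall P : {pred A}, GRing.subalg_closed P ->
        (forall y, S y -> y \in P) -> x \in P >].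

Lemma generated_closed : GRing.subalg_closed generated.
Proof.
split=> [|c x y /asboolP gx /asboolP gy|x y /asboolP gx /asboolP gy];
  apply/asboolP => P cP SP; case: (cP) => P1 PD PM //.
- by apply: PD; [apply: gx | apply: gy].
- by apply: PM; [apply: gx | apply: gy].
Qed.

HB.instance Definition _ :=
  GRing.isSubalgClosed.Build K A generated (GRing.subalg_closed_semi generated_closed).

Record generated_subalgebra :=
  GeneratedSubalgebra { generated_val :> A; _ : generated_val \in generated }.

HB.instance Definition _ := [isSub for generated_val].
HB.instance Definition _ := [Choice of generated_subalgebra by <:].
HB.instance Definition _ := [SubChoice_isSubAlgebra of generated_subalgebra by <:].

End GeneratedSubalgebra.

Notation tseries := (series powers_of_t).

(* o(u) >= k, with o(0) infinite. *)
Definition order_ge n (M : monomials n) (R : nmodType) (k : nat)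
  (u : series M R) : Prop := forall w, (degree w < k)%N -> coef u w = 0.

Definition derivation (R : nzRingType) (B : lalgType R) (D : B -> B) : Prop :=
  linear D /\ forall u v, D (u * v) = D u * v + u * D v.

(* D = [a d/dz]: such a derivation D exists and is unique. *)
Definition derivation_along n (M : monomials n) (R : nzRingType)
    (a : 'I_n -> series M R) (D : series M R -> series M R) : Prop :=
  derivation D /\ forall i, D (variable i) = a i.

(* u(F): F ^ m has order at least the degree of m as soon as o(F) >= 1, so the
   monomials m of degree greater than that of w do not contribute at w. *)
Definition subst n (M : monomials n) (R : nzRingType)
    (F : 'I_n -> series M R) (u : series M R) : series M R :=
  Series (fun w => \sum_(m <- mbelow M (degree w))
    coef u m * coef (\prod_(i <- mword m) F i) w).

Definition deriv_t (V : nmodType) (u : tseries V) : tseries V :=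
  Series (fun m : powers_of_t => coef u (m.+1 : powers_of_t) *+ m.+1).

Section NCSSystem.
Variables (K : comAlgType rat) (A : algType K).
Implicit Types u d : tseries A.

Definition at_minus_t u : tseries A :=
  Series (fun m : powers_of_t => (-1) ^+ m * coef u m).

(* The exponential of a series d with d(0) = 0, so that d ^+ k has no term in
   t ^ m for m < k. *)
Definition exp_t d : tseries A :=
  Series (fun m : powers_of_t => \sum_(k < m.+1)
    ((k`!%:R^-1 : rat)%:A : K) *: coef (d ^+ k) m).

Record quintuple := Quintuple {
  tuple_f : tseries A;
  tuple_g : tseries A;
  tuple_d : tseries A;
  tuple_h : tseries A;
  tuple_m : tseries A
}.

(* The condition d(0) = 0 is what gives a meaning to exp(d(t)). *)
Definition NCS_system (Omega : quintuple) : Prop :=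
  let: Quintuple f g d h m := Omega in
  [/\ coef f 0%N = 1,
      at_minus_t f * g = 1 /\ g * at_minus_t f = 1,
      coef d 0%N = 0 /\ exp_t d = g,
      deriv_t g = g * h
    & deriv_t g = m * g].

End NCSSystem.

Section DifferentialOperators.
Variables (K : comAlgType rat) (n : nat) (M : monomials n) (alpha : nat).

Local Notation Kz := (series M K).
Local Notation Ktz := (series M (tseries K)).

Definition Der (D : endomorphism Kz) : Prop :=
  derivation D /\
  forall k (u : Kz), order_ge k u -> order_ge (k + alpha).-1 (D u).

Definition diff_ops := generated_subalgebra Der.

Implicit Types (F G a : 'I_n -> Ktz) (P : tseries diff_ops) (u : Ktz).

Definition t_coef u (j : nat) : Kz := Series (fun w => coef (coef u w) j).

Definition at_t0 u : Kz := t_coef u 0.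

Definition deriv_t_coefs u : Ktz := Series (fun w => deriv_t (coef u w)).

(* (sum_i t^i P_i) (sum_j t^j u_j) = sum_m t^m sum_(i + j = m) P_i u_j *)
Definition act P u : Ktz :=
  Series (fun w => Series (fun m : powers_of_t =>
    \sum_(i < m.+1)
      coef ((generated_val (coef P (i : nat)) : endomorphism Kz)
        (t_coef u (m - i)%N)) w)).

(* exp(D) u for an operator D which maps every series to a multiple of t. *)
Definition exp_operator (D : Ktz -> Ktz) u : Ktz :=
  Series (fun w => Series (fun m : powers_of_t =>
    \sum_(k < m.+1) (k`!%:R^-1 : rat)%:A * coef (coef (iter k D u) w) m)).

(* For alpha >= 1, [subst F] is an endomorphism of the K[[t]]-algebra
   K[[t]]<<z>>, so that its bijectivity says that F is an automorphism. *)
Definition automorphism_A F : Prop :=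
  let H i := variable i - F i in
  [/\ forall i, order_ge alpha (H i),
      forall i, at_t0 (H i) = 0
    & bijective (subst F)].

(* The first condition is what gives a meaning to u(G). *)
Definition inverse_map F G : Prop :=
  [/\ forall i, order_ge 1 (G i),
      forall i, subst F (G i) = variable i
    & forall i, subst G (F i) = variable i].

Definition D_Log F a : Prop :=
  [/\ forall i, at_t0 (a i) = 0,
      forall i, order_ge alpha (a i)
    & exists2 D, derivation_along a D
        & forall i, exp_operator D (variable i) = F i].

Definition associated_tuple F (Omega : quintuple diff_ops) : Prop :=
  let: Quintuple f g d h m := Omega in
  exists G a,
    let H i := variable i - F i in
    let Mt i := G i - variable i in
    [/\ inverse_map F G /\ D_Log F a,
        coef f 0%N = 1 /\ forall u, act (at_minus_t f) u = subst F u,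
        coef g 0%N = 1 /\ forall u, act g u = subst G u,
        derivation_along a (act (- d))
      & derivation_along (fun i => subst F (deriv_t_coefs (Mt i))) (act h) /\
        derivation_along (fun i => subst G (deriv_t_coefs (H i))) (act m)].

End DifferentialOperators.

(* Main.v *)
Require Import Defs.
From HB Require Import structures.
From mathcomp Require Import all_boot all_order all_algebra.
From mathcomp Require Import boolp mpoly zify.

Set Implicit Arguments.
Unset Strict Implicit.
Unset Printing Implicit Defensive.
Import GRing.Theory.
Local Open Scope ring_scope.

(** The D-Log a of F is a fixed point of a contraction for the t-adic topology,
    so that subst F = exp [a d/dz] and subst (F^-1) = exp (- [a d/dz]) are series
    in t of differential operators; this gives f, g and d. Writing S for the
    automorphism g, the operators S^-1 [d/dt, S] and [d/dt, S] S^-1 are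
    derivations, hence determined by their values on the variables, and these
    values are those of h and m. *)

(** For [alpha = 1] a derivation need not raise the degree in z, so exponentials converge only
    t-adically, whereas the values on the variables control a derivation or an algebra map only
    z-adically; hence two separate principles, [vanish] and [t_vanish]. Neither asks for continuity
    of the maps compared, which the definition of a derivation does not provide. Writing [subst F]
    as an exponential of derivations is what places the coefficients of f and g in the generated
    subalgebra [diff_ops]. Since [act] is faithful, identities between series of operators are
    tested as identities between maps on [Ktz]. Beyond the axioms of [monomials], the two kinds of
    variables enter only through the multiplicativity of products along words, isolated in
    [word_multiplicative]. *)

Section OrderAdditive.
Variables (n : nat) (M : monomials n) (R : zmodType).
Implicit Types (u v : series M R) (k : nat).

Lemma coefD u v m : coef (u + v) m = coef u m + coef v m.
Proof. by []. Qed.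

Lemma coefN u m : coef (- u) m = - coef u m.
Proof. by []. Qed.

Lemma coefB u v m : coef (u - v) m = coef u m - coef v m.
Proof. by []. Qed.

Lemma coef0 m : coef (0 : series M R) m = 0.
Proof. by []. Qed.

Lemma coef_sum I (r : seq I) (P : pred I) (F : I -> series M R) m :
  coef (\sum_(i <- r | P i) F i) m = \sum_(i <- r | P i) coef (F i) m.
Proof. exact: (big_morph (fun u => coef u m) (fun u v => coefD u v m) (coef0 m)). Qed.

Lemma coefMn u k m : coef (u *+ k) m = coef u m *+ k.
Proof. by elim: k => [|k IHk]; rewrite ?mulr0n // !mulrS coefD IHk. Qed.

Lemma order_geT u : order_ge 0 u.
Proof. by []. Qed.

Lemma order_ge0 k : order_ge k (0 : series M R).
Proof. by []. Qed.

Lemma order_geD k u v : order_ge k u -> order_ge k v -> order_ge k (u + v).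
Proof. by move=> ou ov w lt_w; rewrite coefD ou // ov // addr0. Qed.

Lemma order_geN k u : order_ge k u -> order_ge k (- u).
Proof. by move=> ou w lt_w; rewrite coefN ou // oppr0. Qed.

Lemma order_geB k u v : order_ge k u -> order_ge k v -> order_ge k (u - v).
Proof. by move=> ou /order_geN; apply: order_geD. Qed.

Lemma order_geW j k u : (j <= k)%N -> order_ge k u -> order_ge j u.
Proof. by move=> le_jk ou w lt_w; apply: ou; apply: leq_trans le_jk. Qed.

Lemma order_ge_sum k I (r : seq I) (P : pred I) (F : I -> series M R) :
  (forall i, P i -> order_ge k (F i)) -> order_ge k (\sum_(i <- r | P i) F i).
Proof. by move=> oF; apply: big_ind => //; apply: order_geD. Qed.

Lemma order_ge_all u : (forall k, order_ge k u) -> u = 0.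
Proof. by move=> ou; apply/seriesP => m; apply: (ou (degree m).+1). Qed.

End OrderAdditive.

(** * Order filtration and products of series *)

Section OrderRing.
Variables (n : nat) (M : monomials n) (R : nzRingType).
Implicit Types (u v : series M R) (k : nat).

Lemma coefM d u v m : (degree m <= d)%N ->
  coef (u * v) m = \sum_(a <- mbelow M d) \sum_(b <- mbelow M d)
    coef u a * coef v b *+ (mmul a b == m).
Proof. exact: coef_mul. Qed.

Lemma coefZ c u m : coef (c *: u) m = c * coef u m.
Proof. by []. Qed.

Lemma coef1 m : coef (1 : series M R) m = (m == mone)%:R.
Proof. by []. Qed.

Lemma degree_mone : degree (@mone _ M) = 0%N.
Proof.
have := degreeM (@mone _ M) mone; rewrite mmul1m => /eqP.
by rewrite -{1}[degree mone]addn0 eqn_add2l eq_sym => /eqP.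
Qed.

Lemma degree_mvar i : degree (@mvar _ M i) = 1%N.
Proof. exact: size_mword_var. Qed.

Lemma order_geZ k c u : order_ge k u -> order_ge k (c *: u).
Proof. by move=> ou w lt_w; rewrite coefZ ou // mulr0. Qed.

Lemma order_geM j k u v :
  order_ge j u -> order_ge k v -> order_ge (j + k) (u * v).
Proof.
move=> ou ov w lt_w; rewrite (coefM _ _ (leqnn _)) big1 // => a _.
rewrite big1 // => b _; case: eqP => // w_eq; move: lt_w; rewrite -w_eq degreeM.
have [lt_a _|le_ja] := ltnP (degree a) j; first by rewrite ou // mul0r.
have [lt_b _|le_kb] := ltnP (degree b) k; first by rewrite ov // mulr0.
by rewrite ltnNge leq_add.
Qed.

Lemma order_ge_exp k u : order_ge 1 u -> order_ge k (u ^+ k).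
Proof.
move=> ou; elim: k => [|k IHk]; first exact: order_geT.
by rewrite exprS; apply: (@order_geM 1 k).
Qed.

Lemma order_ge_prod (F : 'I_n -> series M R) s : (forall i, order_ge 1 (F i)) ->
  order_ge (size s) (\prod_(i <- s) F i).
Proof.
move=> oF; elim: s => [|i s IHs]; first exact: order_geT.
by rewrite big_cons; apply: (@order_geM 1).
Qed.

Lemma order_ge_monomial m : order_ge (degree m) (monomial m : series M R).
Proof. by move=> w; rewrite /=; case: eqP => // ->; rewrite ltnn. Qed.

Lemma order_ge_variable i : order_ge 1 (variable i : series M R).
Proof. by rewrite -(degree_mvar i); apply: order_ge_monomial. Qed.

Lemma monomialM a b :
  monomial a * monomial b = monomial (mmul a b) :> series M R.
Proof.
apply/seriesP => m; rewrite (coefM _ _ (leqnn _)) /=.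
transitivity (\sum_(x <- mbelow M (degree m)) (\sum_(y <- mbelow M (degree m))
   ((mmul x y == m)%:R *+ (b == y))) *+ (a == x) : R).
  apply: eq_bigr => x _; rewrite -sumrMnl; apply: eq_bigr => y _.
  rewrite (eq_sym x) (eq_sym y).
  by case: (a == x); case: (b == y); rewrite ?mul1r ?mul0r ?mulr0n ?mul0rn.
rewrite sum_below_pick => [|lt_a].
  rewrite sum_below_pick ?(eq_sym m) // => lt_b; case: eqP => // m_eq.
  by move: lt_b; rewrite -m_eq degreeM ltnNge leq_addl.
rewrite big1 // => y _; case: eqP => [m_eq|]; last by rewrite mul0rn.
by move: lt_a; rewrite -m_eq degreeM ltnNge leq_addr.
Qed.

Lemma series1E : 1 = monomial mone :> series M R.
Proof. by []. Qed.

Definition truncation d u := \sum_(m <- mbelow M d) coef u m *: monomial m.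

Lemma order_ge_truncation d u : order_ge d.+1 (u - truncation d u).
Proof.
move=> w lt_wd; rewrite coefB coef_sum.
transitivity (coef u w - \sum_(m <- mbelow M d) coef u m *+ (w == m)).
  by congr (_ - _); apply: eq_bigr => m _; rewrite coefZ /= mulr_natr.
by rewrite sum_below_pick ?subrr // ltnNge -ltnS lt_wd.
Qed.

End OrderRing.

(** * Splitting a series by the first letter of its monomials *)

Section Split.
Variables (n : nat) (M : monomials n) (R : nzRingType).
Implicit Types (u v : series M R).

Let mbehead (m : M) : M := foldr (fun i => mmul (mvar i)) mone (behead (mword m)).

(* The monomials are distributed among the tails according to the first letter
   of their words, which makes sense without any cancellation law. *)
Definition tail i u : series M R := Series (fun b =>
  \sum_(m <- mbelow M (degree b).+1)
    coef u m *+ ((ohead (mword m) == Some i) && (mbehead m == b))).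

Lemma mvar_mbehead m i : ohead (mword m) = Some i ->
  mmul (mvar i) (mbehead m) = m.
Proof.
by rewrite -[X in _ -> _ = X](mword_prod m) /mbehead; case: (mword m) => // j s [->].
Qed.

Lemma coef_variableM i u m : coef (variable i * u) m =
  \sum_(b <- mbelow M (degree m)) coef u b *+ (mmul (mvar i) b == m).
Proof.
rewrite (coefM _ _ (leqnn _)).
transitivity (\sum_(a <- mbelow M (degree m)) (\sum_(b <- mbelow M (degree m))
   (coef u b *+ (mmul a b == m))) *+ (mvar i == a)).
  apply: eq_bigr => a _; rewrite -sumrMnl; apply: eq_bigr => b _ /=.
  by rewrite mulr_natl mulrnAC (eq_sym a).
rewrite sum_below_pick // => lt_i; rewrite big1 // => b _.
case: eqP => // m_eq; by move: lt_i; rewrite -m_eq degreeM ltnNge leq_addr.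
Qed.

(** If [mmul (mvar i) b = m], any [m'] with first letter [i] and remainder [b] equals [m] by
    [mvar_mbehead]; so a single term survives even when several variables divide [m]. *)
Lemma coef_variableM_tail i u m :
  coef (variable i * tail i u) m = coef u m *+ (ohead (mword m) == Some i).
Proof.
rewrite coef_variableM /=.
transitivity (\sum_(b <- mbelow M (degree m)) \sum_(m' <- mbelow M (degree m))
   coef u m' *+ (ohead (mword m') == Some i) *+ (mmul (mvar i) b == m)
     *+ (mbehead m' == b)).
  apply: eq_bigr => b _; case: eqP => [m_eq|_]; last first.
    by rewrite mulr0n big1 // => m' _; rewrite mulr0n mul0rn.
  rewrite mulr1n -m_eq degreeM degree_mvar; apply: eq_bigr => m' _.
  by rewrite mulr1n -mulrnA mulnb.
rewrite exchange_big /=.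
transitivity (\sum_(m' <- mbelow M (degree m))
   coef u m' *+ (ohead (mword m') == Some i) *+ (m == m')).
  apply: eq_bigr => m' _; case: eqP => [hd_m'|_]; last first.
    by rewrite mulr0n mul0rn big1 // => b _; rewrite !mul0rn.
  rewrite sum_below_pick; first by rewrite (mvar_mbehead hd_m') eq_sym.
  rewrite (mvar_mbehead hd_m'); case: eqP => // <-.
  rewrite -{1}(mvar_mbehead hd_m') degreeM degree_mvar => lt_m.
  by have := ltn_trans (leqnn _) lt_m; rewrite ltnn.
by rewrite sum_below_pick ?ltnn.
Qed.

(** Every monomial but [mone] has a nonempty word, whose first letter assigns it to exactly one
    tail. *)
Lemma series_split u :
  u = coef u mone *: 1 + \sum_i variable i * tail i u.
Proof.
apply/seriesP => m; rewrite coefD coef_sum coefZ coef1 mulr_natr.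
under eq_bigr => i _ do rewrite coef_variableM_tail.
case E: (mword m) => [|i s] /=.
  have ->: m = mone by rewrite -(mword_prod m) E.
  by rewrite eqxx big1 ?addr0.
have ->: (m == mone) = false.
  apply/eqP => m1; have := degree_mone M.
  by rewrite -m1 /degree E.
rewrite mulr0n add0r (bigD1 i) //= eqxx big1 ?addr0 // => j ne_ji.
by rewrite (inj_eq Some_inj) eq_sym (negPf ne_ji).
Qed.

Lemma order_ge_tail k i u : order_ge k u -> order_ge k.-1 (tail i u).
Proof.
case: k => [|k] ou w lt_w //; rewrite /= big1 // => m _.
case: eqP => //= hd_m; case: eqP => // eq_w; rewrite ou ?mul0rn //.
by rewrite -(mvar_mbehead hd_m) degreeM degree_mvar eq_w.
Qed.

(* By the splitting of u, delta raises the order of all its values. *)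
Lemma vanish (x : 'I_n -> series M R) (delta : series M R -> series M R) :
  {morph delta : u v / u + v} -> (forall c, delta (c *: 1) = 0) ->
  (forall i, order_ge 1 (x i)) ->
  (forall i u, delta (variable i * u) = x i * delta u) ->
  forall u, delta u = 0.
Proof.
move=> deltaD delta1 ox deltaX u; apply: order_ge_all => k.
have delta0 : delta 0 = 0 by rewrite -{1}(scale0r 1) delta1.
elim: k u => [|k IHk] u; first exact: order_geT.
rewrite (series_split u) deltaD delta1 add0r (big_morph _ deltaD delta0).
by apply: order_ge_sum => i _; rewrite deltaX; apply: (@order_geM _ _ _ 1).
Qed.

End Split.

(** * Commutative coefficients and products along words *)

Section SeriesAlgebra.
Variables (n : nat) (M : monomials n) (R : comNzRingType).

Lemma series_scaleAr (c : R) (u v : series M R) : c *: (u * v) = u * (c *: v).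
Proof.
apply/seriesP => m; rewrite coefZ !(coefM _ _ (leqnn _)) mulr_sumr.
apply: eq_bigr => a _; rewrite mulr_sumr; apply: eq_bigr => b _.
by rewrite coefZ mulrnAr mulrCA.
Qed.

HB.instance Definition _ :=
  GRing.Lalgebra_isAlgebra.Build R (series M R) series_scaleAr.

End SeriesAlgebra.

Section CommutativeSeries.
Variables (n : nat) (M : monomials n) (R : comNzRingType).

Lemma series_mulC : commutative (@mmul n M) -> commutative (@GRing.mul (series M R)).
Proof.
move=> mmulC u v; apply/seriesP => m; rewrite !(coefM _ _ (leqnn _)).
rewrite exchange_big; apply: eq_bigr => a _; apply: eq_bigr => b _ /=.
by rewrite mulrC mmulC.
Qed.

End CommutativeSeries.

(** Substitution is treated over a commutative coefficient ring, and this allows [tseries K] to be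
    one. *)
HB.instance Definition _ (R : comNzRingType) :=
  GRing.PzRing_hasCommutativeMul.Build (tseries R)
    (series_mulC (M := powers_of_t) addnC).

(* The second condition fails for multi-indices over a noncommutative R. *)
Definition word_multiplicative n (M : monomials n) : Prop :=
  (forall i, mword (@mvar n M i) = [:: i]) /\
  forall (R : comNzRingType) (F : 'I_n -> series M R) (a b : M),
    \prod_(i <- mword (mmul a b)) F i
      = (\prod_(i <- mword a) F i) * \prod_(i <- mword b) F i.

Lemma free_word_multiplicative n : word_multiplicative (free_monomials n).
Proof. by split=> // R F a b; rewrite big_cat. Qed.

Lemma perm_multinom_wordD n (a b : 'X_{1..n}) :
  perm_eq (multinom_word (a + b)%MM) (multinom_word a ++ multinom_word b).
Proof.
rewrite /multinom_word; elim: (enum 'I_n) => //= i s IHs.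
by rewrite mnmDE nseqD -!catA perm_cat2l perm_sym perm_catCA perm_cat2l perm_sym.
Qed.

Lemma commutative_word_multiplicative n :
  word_multiplicative (commutative_monomials n).
Proof.
split=> [i|R F a b] /=.
  (* The word of [U_(i)] is a single letter whose product is [U_(i)], so that letter is [i]. *)
  have := multinom_word_prod U_(i); have := size_multinom_word_var i.
  case: (multinom_word U_(i)) => [|j []] //= _.
  rewrite -/(mnm_add _ _) addm0 => /mnmP/(_ i).
  by rewrite !mnm1E eqxx; case: eqP => // ->.
rewrite -big_cat /=.
have mulC := @series_mulC _ (commutative_monomials n) R (@addmC n).
(* The two words agree only up to a permutation, so the product of series is packed as a commutative
   law, which it is in commuting variables. *)
pose mul : Monoid.com_law 1 := HB.pack (@GRing.mul (series (commutative_monomials n) R))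
  (Monoid.isComLaw.Build _ _ _ (@mulrA _) mulC (@mul1r _)).
exact: (perm_big (op := mul) _ (perm_multinom_wordD a b)).
Qed.

Lemma monomials_in_word_multiplicative v n :
  word_multiplicative (monomials_in v n).
Proof.
case: v; first exact: commutative_word_multiplicative.
exact: free_word_multiplicative.
Qed.

(** * Derivations and their values on the variables *)

Section Derivations.
Variables (n : nat) (M : monomials n) (R : nzRingType).
Implicit Types (D : series M R -> series M R) (u v : series M R).

Lemma derivationD D : derivation D -> {morph D : u v / u + v}.
Proof. by case=> linD _ u v; have := linD 1 u v; rewrite !scale1r. Qed.

Lemma derivation0 D : derivation D -> D 0 = 0.
Proof. by move=> derD; apply: (addrI (D 0)); rewrite -(derivationD derD) !addr0. Qed.

Lemma derivationZ D c u : derivation D -> D (c *: u) = c *: D u.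
Proof.
by move=> derD; rewrite -[c *: u]addr0 derD.1 (derivation0 derD) addr0.
Qed.

Lemma derivation_const D c : derivation D -> D (c *: 1) = 0.
Proof.
move=> derD; rewrite (derivationZ _ _ derD); have := derD.2 1 1.
by rewrite !mulr1 mul1r -{1}[D 1]addr0 => /addrI <-; rewrite scaler0.
Qed.

Lemma derivation_split a D u : derivation_along a D ->
  D u = \sum_i (a i * tail i u + variable i * D (tail i u)).
Proof.
case=> derD Da; rewrite {1}(series_split u) (derivationD derD) (derivation_const _ derD).
rewrite add0r (big_morph D (derivationD derD) (derivation0 derD)).
by apply: eq_bigr => i _; rewrite derD.2 Da.
Qed.

(** The terms with the common values [a i] cancel, so the difference of the derivations satisfies
    the hypotheses of [vanish] with [x = variable]. *)
Lemma derivation_along_unique a D1 D2 :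
  derivation_along a D1 -> derivation_along a D2 -> D1 = D2.
Proof.
move=> [der1 D1a] [der2 D2a]; apply/funext => u; apply/eqP; rewrite -subr_eq0.
apply/eqP; move: u; apply: (vanish (x := variable)).
- by move=> u v; rewrite (derivationD der1) (derivationD der2) opprD addrACA.
- by move=> c; rewrite (derivation_const _ der1) (derivation_const _ der2) subrr.
- exact: order_ge_variable.
by move=> i u; rewrite der1.2 der2.2 D1a D2a opprD addrACA subrr add0r mulrBr.
Qed.

(** As [D] is not assumed continuous, the bound is first proved with a cap [j]: in
    [derivation_split] the unknown [D (tail i u)] is multiplied by a variable, which raises the cap
    by one. *)
Lemma derivation_order_ge a D alpha k u : derivation_along a D ->
  (forall i, order_ge alpha (a i)) -> order_ge k u -> order_ge (k + alpha).-1 (D u).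
Proof.
move=> Da oa; have: forall j k u, order_ge k u ->
    order_ge (minn j (k + alpha).-1) (D u).
  move=> j; elim: j => [|j IHj] {}k {}u ou; first by rewrite min0n.
  rewrite (derivation_split u Da); apply: order_ge_sum => i _.
  have ot := order_ge_tail i ou; apply: order_geD.
    by apply: (order_geW _ (order_geM (oa i) ot)); lia.
  apply: (order_geW _ (order_geM (order_ge_variable _ _) (IHj _ _ ot))).
  lia.
by move=> /(_ (k + alpha).-1 k u); rewrite minnn; apply.
Qed.

End Derivations.

(** * Substitution as an algebra endomorphism *)

Section Substitution.
Variables (n : nat) (M : monomials n) (R : comNzRingType).
Hypothesis multM : word_multiplicative M.
Implicit Types (F G : 'I_n -> series M R) (u v : series M R).

Lemma substD F : {morph subst F : u v / u + v}.
Proof.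
move=> u v; apply/seriesP => w; rewrite coefD /= -big_split.
by apply: eq_bigr => m _; rewrite mulrDl.
Qed.

Lemma subst0 F : subst F 0 = 0.
Proof. by apply: (addrI (subst F 0)); rewrite -substD !addr0. Qed.

Lemma substZ F c u : subst F (c *: u) = c *: subst F u.
Proof.
apply/seriesP => w; rewrite coefZ /= mulr_sumr; apply: eq_bigr => m _.
by rewrite mulrA.
Qed.

Lemma substB F : {morph subst F : u v / u - v}.
Proof. by move=> u v; rewrite substD -scaleN1r substZ scaleN1r. Qed.

Lemma subst_sum F I (r : seq I) (P : pred I) (E : I -> series M R) :
  subst F (\sum_(i <- r | P i) E i) = \sum_(i <- r | P i) subst F (E i).
Proof. exact: (big_morph _ (substD F) (subst0 F)). Qed.

Lemma subst_order_ge F k u : order_ge k u -> order_ge k (subst F u).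
Proof.
move=> ou w lt_w /=; rewrite big_seq big1 // => m; rewrite mem_mbelow => le_m.
by rewrite ou ?mul0r //; apply: leq_ltn_trans lt_w.
Qed.

Lemma subst_monomial F m : (forall i, order_ge 1 (F i)) ->
  subst F (monomial m) = \prod_(i <- mword m) F i.
Proof.
move=> oF; apply/seriesP => w /=.
transitivity (\sum_(a <- mbelow M (degree w))
    coef (\prod_(i <- mword a) F i) w *+ (m == a)).
  by apply: eq_bigr => a _; rewrite mulr_natl (eq_sym a).
by rewrite sum_below_pick // => /(order_ge_prod oF).
Qed.

Lemma subst1 F : (forall i, order_ge 1 (F i)) -> subst F 1 = 1.
Proof.
move=> oF; rewrite series1E subst_monomial //; have := degree_mone M.
by rewrite /degree; case: (mword mone) => //; rewrite big_nil.
Qed.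

Lemma subst_variable F i : (forall i, order_ge 1 (F i)) ->
  subst F (variable i) = F i.
Proof. by move=> oF; rewrite subst_monomial // multM.1 big_seq1. Qed.

Lemma subst_truncationM F d u v : (forall i, order_ge 1 (F i)) ->
  subst F (truncation d u * truncation d v)
    = subst F (truncation d u) * subst F (truncation d v).
Proof.
move=> oF; rewrite !subst_sum !mulr_suml subst_sum; apply: eq_bigr => a _.
rewrite !mulr_sumr subst_sum; apply: eq_bigr => b _.
rewrite -scalerAl -scalerAr monomialM !substZ !subst_monomial // multM.2.
by rewrite -scalerAl -scalerAr.
Qed.

Lemma substM F u v : (forall i, order_ge 1 (F i)) ->
  subst F (u * v) = subst F u * subst F v.
Proof.
move=> oF; apply/eqP; rewrite -subr_eq0; apply/eqP/order_ge_all => k.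
have [ou ov] := (@order_ge_truncation _ _ _ k u, @order_ge_truncation _ _ _ k v).
set u' := truncation k u in ou *; set v' := truncation k v in ov *.
(* Telescoping: apart from the product of the truncations, settled by [subst_truncationM], every
   term has order above [k]. A general [f] serves for [id] and [subst F] at once. *)
have uvE (f : series M R -> series M R) : {morph f : x y / x - y} ->
    f u * f v = f u * f (v - v') + f (u - u') * f v' + f u' * f v'.
  by move=> fB; rewrite !fB mulrBr mulrBl addrA !subrK.
rewrite (uvE id) // (uvE _ (@substB F)) !substD subst_truncationM //.
rewrite opprD addrACA subrr addr0.
apply: (order_geW (leqnSn k)); have oS := subst_order_ge F.
have oMl x y : order_ge k.+1 y -> order_ge k.+1 (x * y).
  by move=> oy; apply: (@order_geM _ _ _ 0).
have oMr x y : order_ge k.+1 x -> order_ge k.+1 (x * y).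
  by move=> ox; rewrite -[k.+1]addn0; apply: order_geM.
apply: order_geB; apply: order_geD.
- by apply: oS; apply: oMl.
- by apply: oS; apply: oMr.
- by rewrite -substD; apply: oMl; apply: oS.
by rewrite -substD; apply: oMr; apply: oS.
Qed.

(** The difference of the two maps satisfies [vanish] with [x = F]. This is what identifies
    exponentials of derivations with substitutions. *)
Lemma subst_unique F (S : series M R -> series M R) :
  (forall i, order_ge 1 (F i)) -> {morph S : u v / u + v} ->
  {morph S : u v / u * v} -> (forall c, S (c *: 1) = c *: 1) ->
  (forall i, S (variable i) = F i) -> S =1 subst F.
Proof.
move=> oF SD SM S1 SF u; apply/eqP; rewrite -subr_eq0; apply/eqP.
move: u; apply: (vanish (x := F)) => //.
- by move=> u v; rewrite SD substD opprD addrACA.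
- by move=> c; rewrite S1 substZ subst1 ?subrr.
by move=> i u; rewrite SM substM // SF subst_variable // mulrBr.
Qed.

Lemma subst_id u : subst variable u = u.
Proof.
by symmetry; apply: (@subst_unique _ id) => //; apply: order_ge_variable.
Qed.

Lemma subst_comp F G u :
  (forall i, order_ge 1 (F i)) -> (forall i, order_ge 1 (G i)) ->
  subst F (subst G u) = subst (fun i => subst F (G i)) u.
Proof.
move=> oF oG; apply: (@subst_unique _ (subst F \o subst G)) => /=.
- by move=> i; apply: subst_order_ge.
- by move=> {}u v /=; rewrite !substD.
- by move=> {}u v /=; rewrite !substM.
- by move=> c; rewrite !substZ !subst1.
by move=> i; rewrite subst_variable.
Qed.

End Substitution.

(** * Power series in t and coefficients with respect to t *)

Section PowerSeriesInT.
Variable A : nzRingType.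
Implicit Types p q : tseries A.

Lemma degree_t m : @degree _ powers_of_t m = m.
Proof. exact: size_nseq. Qed.

Lemma coef_tM p q m :
  coef (p * q) m = \sum_(i < m.+1) coef p (i : nat) * coef q (m - i)%N.
Proof.
rewrite (@coefM _ _ _ m) ?degree_t //= -/(iota 0 m.+1).
rewrite -(big_mkord xpredT (fun i => coef p i * coef q (m - i)%N)) /index_iota subn0.
apply: eq_big_seq => a; rewrite mem_iota add0n => /andP[_ lt_am].
rewrite -(@sum_below_pick _ powers_of_t _ m (m - a)%N (fun b => coef p a * coef q b)).
  apply: eq_big_seq => b _ /=; congr (_ *+ nat_of_bool _).
  by apply/eqP/eqP; lia.
by rewrite degree_t ltnNge leq_subr.
Qed.

Lemma coef_t1 m : coef (1 : tseries A) m = (m == 0%N)%:R.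
Proof. by []. Qed.

Definition t_var : tseries A := variable (ord0 : 'I_1).

Lemma coef_t_varM p m :
  coef (t_var * p) m = if m is m'.+1 then coef p m' else 0.
Proof.
rewrite coef_tM; case: m => [|m]; first by rewrite big_ord1 /= mul0r.
rewrite big_ord_recl /= mul0r add0r big_ord_recl /= mul1r subn1 big1 ?addr0 //.
by move=> i _; rewrite /= mul0r.
Qed.

End PowerSeriesInT.
Arguments t_var {A}.

Section TCoefficients.
Variables (K : comAlgType rat) (n : nat) (M : monomials n).
Local Notation Kz := (series M K).
Local Notation Ktz := (series M (tseries K)).
Implicit Types (u v : Ktz) (x y : Kz).

Lemma t_coefP u v : t_coef u =1 t_coef v -> u = v.
Proof.
move=> eq_uv; apply/seriesP => w; apply/seriesP => j.
exact: (congr1 (fun x => coef x w) (eq_uv j)).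
Qed.

Lemma t_coef0 j : t_coef (0 : Ktz) j = 0.
Proof. exact: seriesP. Qed.

Lemma t_coefD u v j : t_coef (u + v) j = t_coef u j + t_coef v j.
Proof. exact: seriesP. Qed.

Lemma t_coefN u j : t_coef (- u) j = - t_coef u j.
Proof. exact: seriesP. Qed.

Lemma t_coefB u v j : t_coef (u - v) j = t_coef u j - t_coef v j.
Proof. exact: seriesP. Qed.

(** Meant for two equal exponentials [u], [u'] with linear terms [v], [v']: if the remainders agree
    at [t ^ j], so do the linear terms. *)
Lemma t_coef_addlI u v v' u' j : u = u' ->
  t_coef (u - v) j = t_coef (u' - v') j -> t_coef v j = t_coef v' j.
Proof. by move=> ->; rewrite !t_coefB => /addrI /oppr_inj. Qed.

Lemma t_coef_sum I (r : seq I) (P : pred I) (F : I -> Ktz) j :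
  t_coef (\sum_(i <- r | P i) F i) j = \sum_(i <- r | P i) t_coef (F i) j.
Proof.
exact: (big_morph (fun u => t_coef u j) (fun u v => t_coefD u v j) (t_coef0 j)).
Qed.

Lemma t_coefM u v j :
  t_coef (u * v) j = \sum_(i < j.+1) t_coef u i * t_coef v (j - i)%N.
Proof.
apply/seriesP => w; rewrite coef_sum [LHS](_ : _ = coef (coef (u * v) w) j) //.
rewrite (coefM _ _ (leqnn _)).
under [RHS]eq_bigr => i _ do rewrite (coefM _ _ (leqnn _)).
rewrite [RHS]exchange_big coef_sum; apply: eq_bigr => a _ /=.
rewrite [RHS]exchange_big coef_sum; apply: eq_bigr => b _ /=.
rewrite sumrMnl; case: eqP => _; last by rewrite !mulr0n.
by rewrite !mulr1n coef_tM.
Qed.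

Lemma t_coef_t_varZ u j :
  t_coef (t_var *: u) j = if j is j'.+1 then t_coef u j' else 0.
Proof. apply/seriesP => w; rewrite [LHS](_ : _ = coef (t_var * coef u w) j) //.
by rewrite coef_t_varM; case: j. Qed.

Lemma t_coef_scalar (c : K) u j :
  t_coef ((c *: 1 : tseries K) *: u) j = c *: t_coef u j.
Proof.
apply/seriesP => w; rewrite [LHS](_ : _ = coef ((c *: 1) * coef u w) j) //.
by rewrite -scalerAl mul1r.
Qed.

Definition const_t x : Ktz := Series (fun w => coef x w *: 1).

Lemma t_coef_const x j : t_coef (const_t x) j = x *+ (j == 0%N).
Proof.
by apply/seriesP => w; rewrite /= mulr_natr; case: eqP.
Qed.

Lemma t_coef_const0 x : t_coef (const_t x) 0 = x.
Proof. by rewrite t_coef_const. Qed.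

Lemma const_tD : {morph const_t : x y / x + y}.
Proof. by move=> x y; apply: t_coefP => j; rewrite t_coefD !t_coef_const mulrnDl. Qed.

Lemma const_tM : {morph const_t : x y / x * y}.
Proof.
move=> x y; apply: t_coefP => j; rewrite t_coefM big_ord_recl !t_coef_const /= subn0.
rewrite mulr1n -mulrnAr big1 ?addr0 // => i _.
by rewrite t_coef_const mul0r.
Qed.

Lemma const_t1 : const_t 1 = 1.
Proof.
apply/seriesP => w; rewrite [LHS](_ : _ = coef (1 : Kz) w *: 1) // !coef1.
case: eqP => _; first by rewrite scale1r.
by rewrite scale0r.
Qed.

Lemma const_tZ c x : const_t (c *: x) = (c *: 1 : tseries K) *: const_t x.
Proof.
by apply/seriesP => w; rewrite /= -scalerAl mul1r scalerA.
Qed.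

Lemma const_t_variable i : const_t (variable i) = variable i.
Proof.
apply/seriesP => w; rewrite /=; case: eqP => _; first by rewrite scale1r.
by rewrite scale0r.
Qed.

Lemma order_ge_const k x : order_ge k x -> order_ge k (const_t x).
Proof. by move=> ox w lt_w; rewrite /= ox // scale0r. Qed.

Lemma order_ge_t_coef k u j : order_ge k u -> order_ge k (t_coef u j).
Proof. by move=> ou w lt_w; rewrite /= ou. Qed.

Lemma order_ge_t_coefs k u : (forall j, order_ge k (t_coef u j)) -> order_ge k u.
Proof.
by move=> ou w lt_w; apply: (@seriesP _ powers_of_t) => j; apply: (ou j w lt_w).
Qed.

Lemma t_split u : exists u', u = const_t (t_coef u 0) + t_var *: u'.
Proof.
exists (Series (fun w => Series (fun j : powers_of_t => coef (coef u w) (j.+1 : powers_of_t)))).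
apply: t_coefP => j; rewrite t_coefD t_coef_t_varZ t_coef_const.
by case: j => [|j]; rewrite ?addr0 // add0r; apply: seriesP.
Qed.

(** By iteration [delta p] is divisible by every power of t. The source [V] is arbitrary so that the
    argument also runs over scalars in [tseries K]. *)
Lemma t_divisible_eq0 (V : Type) (delta : V -> Ktz) :
  (forall p, exists q, delta p = t_var *: delta q) -> forall p, delta p = 0.
Proof.
move=> deltaT p; apply: t_coefP => j; rewrite t_coef0.
by elim: j p => [|j IHj] p; have [q ->] := deltaT p; rewrite t_coef_t_varZ //.
Qed.

(** The t-adic counterpart of [vanish]: an identity compatible with sums and with t has to be
    checked only on series constant in t. *)
Lemma t_vanish (delta : Ktz -> Ktz) : {morph delta : u v / u + v} ->
  (forall u, delta (t_var *: u) = t_var *: delta u) ->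
  (forall x, delta (const_t x) = 0) -> forall u, delta u = 0.
Proof.
move=> deltaD deltaT delta_const; apply: t_divisible_eq0 => u.
have [u' ->] := t_split u; exists u'.
by rewrite deltaD delta_const add0r deltaT.
Qed.

End TCoefficients.

(** * Existence of the derivation with given values on the variables *)

Section DerivationAlong.
Variables (K : comAlgType rat) (n : nat) (M : monomials n).
Hypothesis multM : word_multiplicative M.
Variable b : 'I_n -> series M K.
Hypothesis ob : forall i, order_ge 1 (b i).
Implicit Types x y : series M K.

Let shift i : series M (tseries K) := variable i + t_var *: const_t (b i).
Let shifted x := subst shift (const_t x).

(* The first-order term of u(z + t b). *)
Definition directional x := t_coef (shifted x) 1.

Let order_ge_shift i : order_ge 1 (shift i).
Proof.
apply: order_geD; first exact: order_ge_variable.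
exact/order_geZ/order_ge_const.
Qed.

Let shiftedD : {morph shifted : x y / x + y}.
Proof. by move=> x y; rewrite /shifted const_tD substD. Qed.

Let shiftedM : {morph shifted : x y / x * y}.
Proof. by move=> x y; rewrite /shifted const_tM substM. Qed.

Let shiftedZ c x : shifted (c *: x) = (c *: 1 : tseries K) *: shifted x.
Proof. by rewrite /shifted const_tZ substZ. Qed.

Let shifted_variable i : shifted (variable i) = shift i.
Proof. by rewrite /shifted const_t_variable subst_variable. Qed.

Let t_coef0_shifted x : t_coef (shifted x) 0 = x.
Proof.
apply/eqP; rewrite -subr_eq0; apply/eqP; move: x.
apply: (vanish (x := variable)).
- by move=> x y; rewrite shiftedD t_coefD opprD addrACA.
- move=> c; rewrite shiftedZ t_coef_scalar /shifted const_t1 subst1 //.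
  by rewrite -const_t1 t_coef_const0 subrr.
- exact: order_ge_variable.
move=> i x; rewrite shiftedM t_coefM big_ord1 subnn mulrBr shifted_variable.
by rewrite t_coefD t_coef_t_varZ addr0 -const_t_variable t_coef_const0.
Qed.

(** The substitution of [z + t b] is multiplicative and reduces to the identity at [t = 0], so its
    coefficient of t obeys the Leibniz rule. *)
Lemma derivation_along_directional : derivation_along b directional.
Proof.
rewrite /directional; split; [split|].
- by move=> c x y; rewrite shiftedD shiftedZ t_coefD t_coef_scalar.
- move=> x y; rewrite shiftedM t_coefM !big_ord_recl big_ord0 addr0 /=.
  by rewrite subn0 subnn !t_coef0_shifted addrC.
move=> i; rewrite shifted_variable t_coefD t_coef_t_varZ t_coef_const0.
by rewrite -const_t_variable t_coef_const add0r.
Qed.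

End DerivationAlong.

(** * Action of series of operators *)

Section Action.
Variables (K : comAlgType rat) (n : nat) (M : monomials n) (alpha : nat).
Local Notation Kz := (series M K).
Local Notation Ktz := (series M (tseries K)).
Local Notation ops := (diff_ops K M alpha).
Implicit Types (u v : Ktz) (x y : Kz) (p q : ops) (P Q : tseries ops).

Definition op p : Kz -> Kz := (generated_val p : endomorphism Kz).

Lemma opP p q : op p =1 op q -> p = q.
Proof. by move=> eq_pq; apply/val_inj/endomorphismP. Qed.

Lemma opD p x y : op p (x + y) = op p x + op p y.
Proof. exact: linearD. Qed.

Lemma opZ p c x : op p (c *: x) = c *: op p x.
Proof. exact: linearZ. Qed.

Lemma op0 p : op p 0 = 0.
Proof. exact: linear0. Qed.

Lemma opDl p q x : op (p + q) x = op p x + op q x.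
Proof. by []. Qed.

Lemma opNl p x : op (- p) x = - op p x.
Proof. by []. Qed.

Lemma op0l x : op (0 : ops) x = 0.
Proof. by []. Qed.

Lemma op1l x : op (1 : ops) x = x.
Proof. by []. Qed.

Lemma opMl p q x : op (p * q) x = op p (op q x).
Proof. by []. Qed.

Lemma opZl c p x : op (c *: p) x = c *: op p x.
Proof. by []. Qed.

Lemma opMnl p k x : op (p *+ k) x = op p x *+ k.
Proof. by elim: k => [|k IHk]; rewrite ?mulr0n ?op0l // !mulrS opDl IHk. Qed.

Lemma op_suml I (r : seq I) (S : pred I) (F : I -> ops) x :
  op (\sum_(i <- r | S i) F i) x = \sum_(i <- r | S i) op (F i) x.
Proof. exact: (big_morph (fun p => op p x) (fun p q => opDl p q x) (op0l x)). Qed.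

Lemma t_coef_act P u j :
  t_coef (act P u) j = \sum_(i < j.+1) op (coef P (i : nat)) (t_coef u (j - i)%N).
Proof. by apply/seriesP => w; rewrite coef_sum. Qed.

Lemma t_coef_act_const P x j : t_coef (act P (const_t x)) j = op (coef P j) x.
Proof.
rewrite t_coef_act (bigD1 ord_max) //= subnn t_coef_const0 big1 ?addr0 // => i.
rewrite -val_eqE /= => ne_ij; rewrite t_coef_const subn_eq0 leqNgt.
by rewrite ltn_neqAle ne_ij (ltnSE (ltn_ord i)) op0.
Qed.

Lemma t_coef_act_variable P i j :
  t_coef (act P (variable i)) j = op (coef P j) (variable i).
Proof. by rewrite -const_t_variable t_coef_act_const. Qed.

Lemma actD P : {morph act P : u v / u + v}.
Proof.
move=> u v; apply: t_coefP => j; rewrite t_coefD !t_coef_act -big_split.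
by apply: eq_bigr => i _; rewrite t_coefD opD.
Qed.

Lemma actDl P Q u : act (P + Q) u = act P u + act Q u.
Proof.
apply: t_coefP => j; rewrite t_coefD !t_coef_act -big_split.
by apply: eq_bigr => i _; rewrite opDl.
Qed.

Lemma actNl P u : act (- P) u = - act P u.
Proof.
apply: t_coefP => j; rewrite t_coefN !t_coef_act -sumrN.
by apply: eq_bigr => i _; rewrite opNl.
Qed.

Lemma actBl P Q u : act (P - Q) u = act P u - act Q u.
Proof. by rewrite actDl actNl. Qed.

Lemma act0 P : act P 0 = 0.
Proof. by apply: (addrI (act P 0)); rewrite -actD !addr0. Qed.

Lemma act_t_var P u : act P (t_var *: u) = t_var *: act P u.
Proof.
apply: t_coefP => j; rewrite t_coef_t_varZ t_coef_act; case: j => [|j].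
  by rewrite big_ord1 t_coef_t_varZ op0.
rewrite big_ord_recr /= subnn t_coef_t_varZ op0 addr0 t_coef_act.
by apply: eq_bigr => i _; rewrite t_coef_t_varZ subSn // ltnSE.
Qed.

Lemma act1 u : act (1 : tseries ops) u = u.
Proof.
by apply: t_coefP => j; rewrite t_coef_act big_ord_recl op1l subn0 big1 ?addr0.
Qed.

(** On a series constant in t the coefficient of [t ^ j] reads off [coef P j], so constants already
    separate the operators. *)
Lemma act_ext P Q : (forall x, act P (const_t x) = act Q (const_t x)) -> P = Q.
Proof.
move=> eq_PQ; apply/seriesP => j; apply: opP => x.
by rewrite -!t_coef_act_const eq_PQ.
Qed.

Lemma act_inj P Q : act P =1 act Q -> P = Q.
Proof. by move=> eq_PQ; apply: act_ext => x. Qed.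

Lemma actM P Q u : act (P * Q) u = act P (act Q u).
Proof.
apply/eqP; rewrite -subr_eq0; apply/eqP; move: u; apply: t_vanish.
- by move=> u v; rewrite !actD opprD addrACA.
- by move=> u; rewrite !act_t_var scalerBr.
move=> x; apply: t_coefP => j; rewrite t_coefB t_coef0.
apply/eqP; rewrite subr_eq0; apply/eqP.
rewrite t_coef_act_const coef_tM op_suml t_coef_act.
by apply: eq_bigr => i _; rewrite opMl t_coef_act_const.
Qed.

(** Linearity over [K] and commutation with t extend to all of [tseries K] by peeling off one power
    of t from the scalar at a time. *)
Lemma actZ P (c : tseries K) u : act P (c *: u) = c *: act P u.
Proof.
apply/eqP; rewrite -subr_eq0; apply/eqP; move: c.
apply: t_divisible_eq0 => c.
have [c' ->]: exists c', c = (coef c 0%N *: 1) + t_var * c'.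
  exists (Series (fun j : powers_of_t => coef c (j.+1 : powers_of_t))).
  apply: (@seriesP _ powers_of_t) => -[|j];
    rewrite coefD coef_t_varM coefZ coef_t1 ?mulr1 ?addr0 // mulr0 add0r //.
exists c'; rewrite !scalerDl -!scalerA actD act_t_var scalerBr opprD addrACA.
rewrite [X in X + _](_ : _ = 0) ?add0r //; apply: t_coefP => j.
rewrite t_coefB t_coef_scalar !t_coef_act scaler_sumr -sumrB t_coef0 big1 // => i _.
by rewrite t_coef_scalar opZ subrr.
Qed.

Lemma act_linear P : linear (act P).
Proof. by move=> c u v; rewrite actD actZ. Qed.

Lemma derivation_act P :
  (forall j, derivation (op (coef P j))) -> derivation (act P).
Proof.
move=> derP; split=> [|u v]; first exact: act_linear.
(* Two uses of [t_vanish] reduce to [u] and [v] constant in t, where the coefficient of [t ^ j] is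
   the Leibniz rule of [coef P j]. *)
apply/eqP; rewrite -subr_eq0; apply/eqP; move: u; apply: t_vanish.
- move=> u1 u2; rewrite mulrDl !actD !mulrDl.
  by rewrite (addrACA (act P u1 * v)) opprD addrACA.
- by move=> u; rewrite -!scalerAl !act_t_var -!scalerAl -scalerDr scalerBr.
move=> x; move: v; apply: t_vanish.
- move=> v1 v2; rewrite mulrDr !actD !mulrDr.
  by rewrite (addrACA (act P (const_t x) * v1)) opprD addrACA.
- by move=> v; rewrite -!scalerAr !act_t_var -!scalerAr -scalerDr scalerBr.
move=> y; apply: t_coefP => j; rewrite t_coef0 t_coefB t_coefD -const_tM.
rewrite t_coef_act_const (derP j).2 !t_coefM.
rewrite (bigD1 ord_max) //= subnn t_coef_act_const t_coef_const0 big1 ?addr0.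
  rewrite big_ord_recl /= subn0 t_coef_act_const t_coef_const0 big1 ?addr0 ?subrr //.
  by move=> i _; rewrite t_coef_const mul0r.
move=> i; rewrite -val_eqE /= => ne_ij; rewrite t_coef_const subn_eq0 leqNgt.
by rewrite ltn_neqAle ne_ij (ltnSE (ltn_ord i)) mulr0.
Qed.

Lemma derivation_along_act P (a : 'I_n -> Ktz) :
  (forall j, derivation_along (fun i => t_coef (a i) j) (op (coef P j))) ->
  derivation_along a (act P).
Proof.
move=> derP; split=> [|i]; first by apply: derivation_act => j; case: (derP j).
by apply: t_coefP => j; rewrite t_coef_act_variable (derP j).2.
Qed.

End Action.

(** Regrouping along antidiagonals, for products of two exponentials: there the term of exponents
    [j] and [k] is divisible by [t ^ (j + k)]. *)
Lemma sum_triangle (V : zmodType) m (X : nat -> nat -> V) :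
  (forall j k, (m < j + k)%N -> X j k = 0) ->
  \sum_(j < m.+1) \sum_(k < m.+1) X j k = \sum_(s < m.+1) \sum_(j < s.+1) X j (s - j)%N.
Proof.
move=> X0.
transitivity (\sum_(j < m.+1) \sum_(s < m.+1 | (j <= s)%N) X j (s - j)%N).
  apply: eq_bigr => j _.
  rewrite -(big_mkord xpredT (X j)) -(big_mkord (fun s => (j <= s)%N) (fun s => X j (s - j)%N)).
  rewrite (@big_cat_nat _ _ _ (m.+1 - j)%N) ?leq_subr //=.
  rewrite [X in _ + X]big_nat_cond [X in _ + X]big1 ?addr0; last first.
    by move=> k /andP[/andP[le_k _] _]; rewrite X0 //; have := ltn_ord j; lia.
  rewrite [RHS](@big_cat_nat _ _ _ j) ?(ltnW (ltn_ord j)) //=.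
  rewrite [X in _ = X + _]big_nat_cond [X in _ = X + _]big1 ?add0r; last first.
    by move=> k /andP[/andP[_ lt_kj]]; rewrite leqNgt lt_kj.
  rewrite [RHS](_ : _ = \sum_(0 + j <= s < m.+1 | (j <= s)%N) X j (s - j)%N) //.
  rewrite big_addn [RHS]big_mkcond big_nat [RHS]big_nat.
  by apply: eq_bigr => k _; rewrite leq_addl addnK.
rewrite (exchange_big_dep xpredT) //=; apply: eq_bigr => s _.
rewrite -(big_mkord (fun j => (j <= s)%N) (fun j => X j (s - j)%N)).
rewrite -(big_mkord xpredT (fun j => X j (s - j)%N)).
rewrite (@big_cat_nat _ _ _ s.+1) ?(ltn_ord s) //=.
rewrite [X in _ + X]big_nat_cond [X in _ + X]big1 ?addr0; last first.
  by move=> k /andP[/andP[lt_sk _]]; rewrite leqNgt lt_sk.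
rewrite big_nat_cond [RHS]big_nat_cond; apply: eq_bigl => k.
by rewrite ltnS; lia.
Qed.

(** * Exponentials of series in t without constant term *)

Section InverseFactorials.
Variable K : comAlgType rat.

Definition inv_fact k : K := (k`!%:R^-1 : rat)%:A.

Lemma inv_fact0 : inv_fact 0 = 1.
Proof. by rewrite /inv_fact fact0 invr1 scale1r. Qed.

Lemma inv_fact1 : inv_fact 1 = 1.
Proof. by rewrite /inv_fact invr1 scale1r. Qed.

Lemma inv_factM s j : (j <= s)%N ->
  inv_fact j * inv_fact (s - j) = inv_fact s * 'C(s, j)%:R.
Proof.
move=> le_js; rewrite /inv_fact -scalerAl mul1r scalerA -scalerAl mul1r.
rewrite -[X in _ = _ *: X](scaler_nat _ (1 : K)) scalerA; congr (_ *: _).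
have nz k : (k`!%:R : rat) != 0 by rewrite Num.Theory.pnatr_eq0 -lt0n fact_gt0.
rewrite -(bin_fact le_js) !natrM; set b := 'C(s, j)%:R; have b_nz : b != 0.
  by rewrite /b Num.Theory.pnatr_eq0 -lt0n bin_gt0.
by rewrite !invfM [RHS]mulrC mulVKf.
Qed.

End InverseFactorials.

Section Exponential.
Variables (K : comAlgType rat) (A : algType K).
Implicit Types P Q : tseries A.

Lemma order_ge_t P k : (forall m, (m < k)%N -> coef P m = 0) -> order_ge k P.
Proof. by move=> P0 m; rewrite degree_t; apply: P0. Qed.

Lemma order_ge_t_coef0 P k m : order_ge k P -> (m < k)%N -> coef P m = 0.
Proof. by move=> oP lt_mk; apply: oP; rewrite degree_t. Qed.

(** A cutoff [N] independent of [m] lets coefficients of different degrees share one range of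
    summation, so that sums can be exchanged. *)
Lemma coef_exp_t N P m : order_ge 1 P -> (m <= N)%N ->
  coef (exp_t P) m = \sum_(k < N.+1) inv_fact K k *: coef (P ^+ k) m.
Proof.
move=> oP le_mN; rewrite [LHS](big_ord_widen N.+1
  (fun k => inv_fact K k *: coef (P ^+ k) m)) // big_mkcond /=.
apply: eq_bigr => k _; case: ltnP => // lt_mk.
by rewrite (order_ge_t_coef0 (order_ge_exp oP)) ?scaler0.
Qed.

(** In the telescoped difference every factor other than the single [P - Q] contributes one power of
    t, whence [k.-1]. *)
Lemma order_ge_expB N P Q k : order_ge 1 P -> order_ge 1 Q ->
  order_ge N (P - Q) -> order_ge (N + k.-1) (P ^+ k - Q ^+ k).
Proof.
move=> oP oQ oPQ; case: k => [|k]; first by rewrite subrr; apply: order_ge0.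
elim: k => [|k IHk]; first by rewrite addn0.
have ->: P ^+ k.+2 - Q ^+ k.+2 = P * (P ^+ k.+1 - Q ^+ k.+1) + (P - Q) * Q ^+ k.+1.
  by rewrite mulrBr mulrBl -!exprS addrA subrK.
apply: order_geD; last by apply: order_geM => //; apply: order_ge_exp.
by have := order_geM oP IHk; rewrite add1n -addnS.
Qed.

(* The terms of degree at least two of the exponential gain one power of t. *)
Lemma exp_t_contraction N P Q : order_ge 1 P -> order_ge 1 Q ->
  order_ge N (P - Q) -> order_ge N.+1 (exp_t P - P - (exp_t Q - Q)).
Proof.
move=> oP oQ oPQ; apply: order_ge_t => m; rewrite ltnS => le_mN.
(* The cutoff [N.+1] leaves the exponents 0 and 1 to split off even for [N = 0]; the index [i] of
   the remaining sums then stands for the exponent [i + 2]. *)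
rewrite !coefB !(@coef_exp_t N.+1) ?(leqW le_mN) //.
rewrite !big_ord_recl !inv_fact1 !inv_fact0 !scale1r !expr0 !expr1.
set p := \sum_i _; set q := \sum_i _.
have ->: p = q.
  apply/eqP; rewrite -subr_eq0 -sumrB big1 // => i _; rewrite -scalerBr -coefB.
  rewrite (order_ge_t_coef0 (order_ge_expB oP oQ oPQ)) ?scaler0 //=.
  by rewrite addnS ltnS (leq_trans le_mN) ?leq_addr.
have cancel x y z : x + (y + z) - y = x + z :> A by rewrite addrA addrAC addrK.
by rewrite !cancel subrr.
Qed.

(** Sorted by total exponent [s], the product collects [(-1 + 1) ^ s / s!] times [P ^ s], which
    vanishes for [s > 0]. *)
Lemma exp_t_mulN P : order_ge 1 P -> exp_t P * exp_t (- P) = 1.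
Proof.
move=> oP; have oNP := order_geN oP; apply: (@seriesP _ powers_of_t) => m.
rewrite coef_tM.
transitivity (\sum_(j < m.+1) \sum_(k < m.+1)
    (inv_fact K j * inv_fact K k) *: coef (P ^+ j * (- P) ^+ k) m).
  under eq_bigr => i _.
    rewrite !(@coef_exp_t m) ?leq_subr ?(ltnSE (ltn_ord i)) // mulr_suml.
    under eq_bigr => j _ do rewrite mulr_sumr.
    over.
  rewrite [LHS]exchange_big; apply: eq_bigr => j _.
  rewrite [LHS]exchange_big; apply: eq_bigr => k _.
  rewrite coef_tM scaler_sumr; apply: eq_bigr => i _.
  by rewrite -scalerAl -scalerAr scalerA.
rewrite (sum_triangle (X := fun j k => (inv_fact K j * inv_fact K k) *:
    coef (P ^+ j * (- P) ^+ k) m)); last first.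
  move=> j k lt_m; rewrite (order_ge_t_coef0 _ lt_m) ?scaler0 //.
  by apply: order_geM; apply: order_ge_exp.
rewrite big_ord_recl big_ord1 subn0 inv_fact0 !mulr1 scale1r big1 ?addr0 // => s _.
set r := (lift ord0 s : nat).
transitivity ((inv_fact K r * (-1 + 1) ^+ r) *: coef (P ^+ r) m); last first.
  by rewrite addNr expr0n /= mulr0 scale0r.
(* Signs move from [tseries A] to the scalars, so that the binomial theorem is applied in [K]. *)
have coef_sign k Q : coef ((-1) ^+ k * Q) m = (-1 : K) ^+ k *: coef Q m.
  elim: k => [|k IHk]; first by rewrite mul1r scale1r.
  by rewrite !exprS -mulrA mulN1r coefN IHk -scaleNr mulN1r.
rewrite exprDn mulr_sumr scaler_suml; apply: eq_bigr => j _.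
have le_js := ltnSE (ltn_ord j).
rewrite inv_factM // exprNn mulrA (commrX _ (commrN1 _)) -mulrA -exprD.
by rewrite subnKC // coef_sign scalerA expr1n mulr1 -mulrA mulr_natl.
Qed.

End Exponential.

Lemma leibniz_iter (R : nzRingType) (B : lalgType R) (D : B -> B) (u v : B) s :
  derivation D ->
  iter s D (u * v) = \sum_(j < s.+1) (iter j D u * iter (s - j) D v) *+ 'C(s, j).
Proof.
move=> [linD mulD].
have DD : {morph D : x y / x + y} by move=> x y; have := linD 1 x y; rewrite !scale1r.
have D0 : D 0 = 0 by apply: (addrI (D 0)); rewrite -DD !addr0.
have DMn k : {morph D : x / x *+ k}.
  by move=> x; elim: k => [|k IHk]; rewrite ?mulr0n // !mulrS DD IHk.
elim: s => [|s IHs]; first by rewrite big_ord1 bin0.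
rewrite iterS IHs (big_morph D DD D0).
pose X j := iter j D u * iter (s.+1 - j) D v.
transitivity (\sum_(j < s.+1) (X j.+1 *+ 'C(s, j) + X j *+ 'C(s, j))).
  apply: eq_bigr => j _; rewrite DMn mulD mulrnDl /X subSS.
  by rewrite subSn ?(ltnSE (ltn_ord j)).
rewrite big_split /= [in RHS]big_ord_recl /=.
under [in RHS]eq_bigr => j _ do rewrite binS mulrnDr -/(X j.+1).
rewrite big_split /= addrA addrC; congr (_ + _).
have <- : \sum_(j < s.+2) X j *+ 'C(s, j) = \sum_(j < s.+1) X j *+ 'C(s, j).
  by rewrite big_ord_recr /= bin_small // mulr0n addr0.
rewrite big_ord_recl /=.
by rewrite !bin0.
Qed.

(** * Exponentials of derivations are substitutions *)

Section ExponentialAction.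
Variables (K : comAlgType rat) (n : nat) (M : monomials n) (alpha : nat).
Local Notation Kz := (series M K).
Local Notation Ktz := (series M (tseries K)).
Local Notation ops := (diff_ops K M alpha).
Implicit Types (u v : Ktz) (P Q : tseries ops).

Lemma act_exp P k u : act (P ^+ k) u = iter k (act P) u.
Proof.
by elim: k => [|k IHk]; rewrite ?act1 // exprS actM IHk.
Qed.

Lemma t_coef_act_lt P k m u : order_ge k P -> (m < k)%N -> t_coef (act P u) m = 0.
Proof.
move=> oP lt_mk; rewrite t_coef_act big1 // => i _.
rewrite (order_ge_t_coef0 oP) ?op0l // (leq_ltn_trans _ lt_mk) //.
exact: ltnSE (ltn_ord i).
Qed.

Lemma t_coef_exp_operator (D : Ktz -> Ktz) u m :
  t_coef (exp_operator D u) m =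
    \sum_(k < m.+1) inv_fact K k *: t_coef (iter k D u) m.
Proof. by apply/seriesP => w; rewrite coef_sum. Qed.

Lemma t_coef_act_exp_t N P u m : order_ge 1 P -> (m <= N)%N ->
  t_coef (act (exp_t P) u) m =
    \sum_(k < N.+1) inv_fact K k *: t_coef (act (P ^+ k) u) m.
Proof.
move=> oP le_mN; rewrite t_coef_act.
under eq_bigr => i _.
  rewrite (coef_exp_t oP (leq_trans (ltnSE (ltn_ord i)) le_mN)) op_suml.
  under eq_bigr => k _ do rewrite opZl.
  over.
rewrite exchange_big; apply: eq_bigr => k _.
by rewrite t_coef_act scaler_sumr.
Qed.

Lemma act_exp_t P u : order_ge 1 P -> act (exp_t P) u = exp_operator (act P) u.
Proof.
move=> oP; apply: t_coefP => m; rewrite (t_coef_act_exp_t _ oP (leqnn m)).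
by rewrite t_coef_exp_operator; apply: eq_bigr => k _; rewrite act_exp.
Qed.

(** The iterated Leibniz rule, with its binomials absorbed by [inv_factM], turns the left side into
    the double sum of [P ^ j u] times [P ^ k v] over [j! k!], which is also the product of the
    exponentials. *)
Lemma act_exp_tM P u v : order_ge 1 P -> derivation (act P) ->
  act (exp_t P) (u * v) = act (exp_t P) u * act (exp_t P) v.
Proof.
move=> oP derP; apply: t_coefP => m.
rewrite (t_coef_act_exp_t _ oP (leqnn m)) t_coefM.
transitivity (\sum_(j < m.+1) \sum_(k < m.+1) (inv_fact K j * inv_fact K k) *:
    t_coef (act (P ^+ j) u * act (P ^+ k) v) m).
  rewrite (sum_triangle (X := fun j k => (inv_fact K j * inv_fact K k) *:
      t_coef (act (P ^+ j) u * act (P ^+ k) v) m)).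
    apply: eq_bigr => s _; rewrite act_exp leibniz_iter // t_coef_sum scaler_sumr.
    apply: eq_bigr => j _; rewrite inv_factM ?(ltnSE (ltn_ord j)) //.
    rewrite -!act_exp -scalerA scaler_nat; congr (_ *: _).
    elim: 'C(_, _) => [|k IHk]; first by rewrite !mulr0n t_coef0.
    by rewrite !mulrS t_coefD IHk.
  (* When [j + k > m], either [i < j] or [m - i < k], so one factor vanishes. *)
  move=> j k lt_m; rewrite t_coefM big1 ?scaler0 // => i _.
  have oPk l := @order_ge_exp _ _ _ l _ oP.
  have [lt_ij|le_ji] := ltnP i j; first by rewrite (t_coef_act_lt _ (oPk j)) ?mul0r.
  by rewrite [X in _ * X](t_coef_act_lt _ (oPk k)) ?mulr0 //; have := ltn_ord i; lia.
symmetry; under eq_bigr => i _.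
  rewrite (t_coef_act_exp_t _ oP (ltnSE (ltn_ord i))).
  rewrite (t_coef_act_exp_t _ oP (leq_subr i m)) mulr_suml.
  under eq_bigr => j _ do rewrite mulr_sumr.
  over.
rewrite [LHS]exchange_big; apply: eq_bigr => j _.
rewrite [LHS]exchange_big; apply: eq_bigr => k _.
rewrite t_coefM scaler_sumr; apply: eq_bigr => i _.
by rewrite -scalerAl -scalerAr scalerA.
Qed.

Lemma act_exp_t_const P c : order_ge 1 P -> derivation (act P) ->
  act (exp_t P) (c *: 1) = c *: 1.
Proof.
move=> oP derP; rewrite actZ; congr (_ *: _); apply: t_coefP => m.
rewrite (t_coef_act_exp_t _ oP (leqnn m)) big_ord_recl expr0 act1 inv_fact0 scale1r.
rewrite big1 ?addr0 // => k _; rewrite act_exp /= -iterS iterSr.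
have D1 : act P 1 = 0 by rewrite -(derivation_const 1 derP) scale1r.
have D0 : act P 0 = 0 by rewrite act0.
rewrite D1 (_ : iter k (act P) 0 = 0) ?t_coef0 ?scaler0 //.
by elim: (nat_of_ord k) => //= l ->.
Qed.

Lemma act_exp_t_subst P (F : 'I_n -> Ktz) : word_multiplicative M ->
  order_ge 1 P -> derivation (act P) -> (forall i, order_ge 1 (F i)) ->
  (forall i, act (exp_t P) (variable i) = F i) -> act (exp_t P) =1 subst F.
Proof.
move=> multM oP derP oF PF; apply: subst_unique => //.
- exact: actD.
- by move=> u v; apply: act_exp_tM.
by move=> c; apply: act_exp_t_const.
Qed.

Lemma act_exp_t_contraction N P Q u j : order_ge 1 P -> order_ge 1 Q ->
  order_ge N (P - Q) -> (j <= N)%N ->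
  t_coef (act (exp_t P) u - act P u) j = t_coef (act (exp_t Q) u - act Q u) j.
Proof.
move=> oP oQ oPQ le_jN; have oE := exp_t_contraction oP oQ oPQ.
have E : act (exp_t P - P - (exp_t Q - Q)) u
    = (act (exp_t P) u - act P u) - (act (exp_t Q) u - act Q u).
  transitivity (act (exp_t P - P) u - act (exp_t Q - Q) u); first exact: actBl.
  by congr (_ - _); apply: actBl.
have := t_coef_act_lt u oE (ltnSE le_jN).
move=> H; apply/eqP; rewrite -subr_eq0 -t_coefB; apply/eqP.
exact: etrans (congr1 (fun v => t_coef v j) (esym E)) H.
Qed.

End ExponentialAction.

(** * Vector fields depending on t, and the logarithm of an automorphism *)

Section VectorFields.
Variables (K : comAlgType rat) (n : nat) (M : monomials n) (alpha : nat).
Hypothesis multM : word_multiplicative M.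
Hypothesis alpha_ge1 : (1 <= alpha)%N.
Local Notation Kz := (series M K).
Local Notation Ktz := (series M (tseries K)).
Local Notation ops := (diff_ops K M alpha).
Implicit Types (P Q : tseries ops) (b : 'I_n -> Kz) (a : 'I_n -> Ktz) (u : Ktz).

(** Order at least 1 makes the substitution of [z + t b] multiplicative, and [derivation_order_ge]
    supplies the degree condition that puts the derivation among the generators. *)
Lemma vector_op_exists b : (forall i, order_ge alpha (b i)) ->
  exists p : ops, derivation_along b (op p).
Proof.
move=> ob; have ob1 i := order_geW alpha_ge1 (ob i).
have along_b := derivation_along_directional multM ob1.
have [[linD _] _] := along_b.
pose D : endomorphism Kz := HB.pack (directional b) (GRing.isLinear.Build _ _ _ _ _ linD).
have genD : D \in generated (@Der K n M alpha).
  apply/asboolP => S _; apply; split; first by case: along_b.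
  by move=> k u ou; apply: derivation_order_ge along_b ob ou.
by exists (GeneratedSubalgebra genD).
Qed.

(** The coefficients of a general [P] are polynomial expressions in derivations; this singles out
    the elements of [Der[[t]]], for which values on the variables suffice. *)
Definition vectorial P := forall j,
  exists2 b, forall i, order_ge alpha (b i) & derivation_along b (op (coef P j)).

Lemma vectorial0 : vectorial 0.
Proof.
move=> j; exists (fun=> 0) => //; split=> //; split.
  by move=> c x y; rewrite !op0l scaler0 addr0.
by move=> x y; rewrite !op0l mul0r mulr0 addr0.
Qed.

Lemma vectorial_derivation P : vectorial P -> derivation (act P).
Proof. by move=> vecP; apply: derivation_act => j; have [b _ []] := vecP j. Qed.

Lemma vectorial_along P : vectorial P ->
  derivation_along (fun i => act P (variable i)) (act P).
Proof. by move/vectorial_derivation. Qed.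

Lemma vectorial_order_ge P u : vectorial P -> order_ge 1 u ->
  order_ge alpha (act P u).
Proof.
move=> vecP ou; apply: order_ge_t_coefs => j; rewrite t_coef_act.
apply: order_ge_sum => i _; have [b ob along_b] := vecP i.
exact: (derivation_order_ge along_b ob (order_ge_t_coef _ ou)).
Qed.

Lemma vectorial_iter_order_ge P u k : vectorial P -> order_ge 1 u ->
  order_ge alpha (iter k.+1 (act P) u).
Proof.
move=> vecP ou; elim: k => [|k IHk]; first exact: vectorial_order_ge.
rewrite iterS; apply: vectorial_order_ge => //; exact: order_geW alpha_ge1 IHk.
Qed.

Lemma act_exp_t_order_ge P u : order_ge 1 P -> vectorial P -> order_ge 1 u ->
  order_ge alpha (act (exp_t P) u - u).
Proof.
move=> oP vecP ou; apply: order_ge_t_coefs => j.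
rewrite t_coefB (t_coef_act_exp_t _ oP (leqnn j)) big_ord_recl inv_fact0 scale1r.
rewrite expr0 act1 addrC addKr; apply: order_ge_sum => k _.
rewrite act_exp; apply/order_geZ/order_ge_t_coef.
exact: vectorial_iter_order_ge.
Qed.

Lemma vectorial_exists a : (forall i, order_ge alpha (a i)) ->
  exists P, vectorial P /\ derivation_along a (act P).
Proof.
move=> oa.
have /choice [vf vfP] : forall j, exists p : ops,
    derivation_along (fun i => t_coef (a i) j) (op p).
  by move=> j; apply: vector_op_exists => i; apply: order_ge_t_coef.
exists (Series (fun j : powers_of_t => vf j)); split; last exact: derivation_along_act.
by move=> j; exists (fun i => t_coef (a i) j) => // i; apply: order_ge_t_coef.
Qed.

Lemma derivation_along_act_inj a P Q :
  derivation_along a (act P) -> derivation_along a (act Q) -> P = Q.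
Proof.
move=> aP aQ; apply: act_inj => u.
by rewrite (derivation_along_unique aP aQ).
Qed.

(** Comparison one power of t at a time, as needed by the t-adic inductions for the logarithm. *)
Lemma vectorial_coef_eq P Q j : vectorial P -> vectorial Q ->
  (forall i, t_coef (act P (variable i)) j = t_coef (act Q (variable i)) j) ->
  coef P j = coef Q j.
Proof.
move=> vecP vecQ eq_PQ; have [b _ along_b] := vecP j; have [b' _ along_b'] := vecQ j.
have eq_b : b = b'.
  by apply/funext => i; rewrite -along_b.2 -along_b'.2 -!t_coef_act_variable.
rewrite -eq_b in along_b'; apply: opP => x.
by rewrite (derivation_along_unique along_b along_b').
Qed.

Lemma vectorial_coef_eq0 P j : vectorial P ->
  (forall i, t_coef (act P (variable i)) j = 0) -> coef P j = 0.
Proof.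
move=> vecP P0; apply: (@vectorial_coef_eq P 0 j vecP vectorial0) => i.
by rewrite P0 t_coef_act_variable op0l.
Qed.

Lemma order_ge1_vectorial P : vectorial P ->
  (forall i, at_t0 (act P (variable i)) = 0) -> order_ge 1 P.
Proof.
move=> vecP P0; apply: order_ge_t => -[|] // _.
exact: vectorial_coef_eq0.
Qed.

(** If [P] and [Q] agree below [t ^ N], the nonlinear parts of their exponentials agree up to
    [t ^ N] included, hence so do the linear parts. *)
Lemma act_exp_t_inj P Q : order_ge 1 P -> order_ge 1 Q ->
  vectorial P -> vectorial Q ->
  (forall i, act (exp_t P) (variable i) = act (exp_t Q) (variable i)) -> P = Q.
Proof.
move=> oP oQ vecP vecQ eq_exp; apply/eqP; rewrite -subr_eq0; apply/eqP.
apply: order_ge_all; elim=> [|N IHN]; first exact: order_geT.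
apply: order_ge_t => m; rewrite ltnS leq_eqVlt => /predU1P[->|]; last first.
  exact: order_ge_t_coef0.
apply/eqP; rewrite coefB subr_eq0; apply/eqP/vectorial_coef_eq => // i.
exact: t_coef_addlI (eq_exp i) (act_exp_t_contraction _ oP oQ IHN (leqnn N)).
Qed.

Section Logarithm.
Variable F : 'I_n -> Ktz.
Hypothesis oF : forall i, order_ge alpha (variable i - F i).
Hypothesis F0 : forall i, at_t0 (variable i - F i) = 0.

(** The equation [exp(P) z = F] solved for its linear term: the value that the next approximation of
    [P] must take on the variable. *)
Let log_step_target P i : Ktz :=
  F i - (act (exp_t P) (variable i) - act P (variable i)).

Let order_ge_target P i : order_ge 1 P -> vectorial P ->
  order_ge alpha (log_step_target P i).
Proof.
move=> oP vecP; have oX := @order_ge_variable _ M (tseries K) i.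
(* Inserting the variable as [z] leaves three pieces, each of order at least [alpha]. *)
have split_target (V : zmodType) (x y z p : V) :
    x - (y - p) = p - (z - x) - (y - z).
  by rewrite !opprB -addrA (addrA (x - z)) subrK addrCA.
rewrite /log_step_target (split_target _ _ _ (variable i)).
apply: order_geB; last exact: act_exp_t_order_ge.
by apply: order_geB => //; apply: vectorial_order_ge.
Qed.

(* Fixed point of a contraction for the t-adic topology. *)
Lemma log_exists : exists P,
  [/\ order_ge 1 P, vectorial P
    & forall i, act (exp_t P) (variable i) = F i].
Proof.
(* [Phi] has to be total, so vectors of lower order receive the default operator 0. *)
have /choice [vf vfP] : forall b, exists p : ops,
    (forall i, order_ge alpha (b i)) -> derivation_along b (op p).
  move=> b; have [ob|] := pselect (forall i, order_ge alpha (b i)); last by exists 0.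
  by have [p pb] := vector_op_exists ob; exists p.
pose Phi P : tseries ops :=
  Series (fun j : powers_of_t => vf (fun i => t_coef (log_step_target P i) j)).
pose good P := order_ge 1 P /\ vectorial P.
have PhiE P j i : good P ->
    t_coef (act (Phi P) (variable i)) j = t_coef (log_step_target P i) j.
  move=> [oP vecP]; rewrite t_coef_act_variable (vfP _ _).2 // => k.
  exact/order_ge_t_coef/order_ge_target.
have vecPhi P : good P -> vectorial (Phi P).
  move=> [oP vecP] j; exists (fun i => t_coef (log_step_target P i) j).
    by move=> i; apply/order_ge_t_coef/order_ge_target.
  by apply: vfP => i; apply/order_ge_t_coef/order_ge_target.
have goodPhi P : good P -> good (Phi P).
  move=> gP; split; last exact: vecPhi.
  apply: order_ge1_vectorial => [|i]; first exact: vecPhi.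
  have [oP _] := gP; rewrite /at_t0 PhiE // /log_step_target.
  (* At [t = 0] both [F i] and the exponential give the variable, and [act P] gives 0, so the target
     vanishes there. *)
  have FX : t_coef (F i) 0 = t_coef (variable i) 0.
    by apply/eqP; rewrite eq_sym -subr_eq0 -t_coefB; apply/eqP/F0.
  rewrite (t_coefB (F i)) (t_coefB (act (exp_t P) _)) FX.
  rewrite (t_coef_act_lt _ oP) // subr0.
  rewrite (t_coef_act_exp_t _ oP (leqnn 0)) big_ord1 expr0 act1 inv_fact0 scale1r.
  exact: subrr.
have contr N P Q : good P -> good Q -> order_ge N (P - Q) ->
    order_ge N.+1 (Phi P - Phi Q).
  move=> gP gQ oPQ; have [[oP _] [oQ _]] := (gP, gQ).
  apply: order_ge_t => m lt_m; apply/eqP; rewrite coefB subr_eq0; apply/eqP.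
  apply: vectorial_coef_eq => [||i]; try exact: vecPhi.
  rewrite (PhiE P) // (PhiE Q) // (t_coefB (F i)) [RHS](t_coefB (F i)).
  by congr (_ - _); apply: act_exp_t_contraction oPQ _.
pose S N := iter N Phi 0.
have goodS N : good (S N).
  elim: N => [|N IHN]; last exact: goodPhi.
  by split; [apply: order_ge0 | apply: vectorial0].
have stepS N : order_ge N.+1 (S N.+1 - S N).
  elim: N => [|N IHN]; last exact: (contr _ _ _ (goodS _) (goodS _) IHN).
  by rewrite subr0; case: (goodS 1%N).
have coefS m N : (m <= N)%N -> coef (S N) m = coef (S m) m.
  elim: N => [|N IHN]; first by rewrite leqn0 => /eqP ->.
  rewrite leq_eqVlt => /predU1P[-> //|le_mN]; rewrite -IHN //.
  apply/eqP; rewrite -subr_eq0 -coefB; apply/eqP.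
  exact: order_ge_t_coef0 (stepS N) le_mN.
(* Diagonal limit: by [coefS] the coefficient of [t ^ j] is stationary from the [j]-th iterate
   on. *)
pose P : tseries ops := Series (fun j : powers_of_t => coef (S j) j).
have oPS N : order_ge N.+1 (P - S N).
  by apply: order_ge_t => m lt_m; rewrite coefB coefS ?subrr.
have gP : good P.
  split; last by move=> j; apply: (goodS j).2.
  by apply: order_ge_t => -[|].
have PhiP : Phi P = P.
  apply/eqP; rewrite -subr_eq0; apply/eqP/order_ge_all => N.
  (* [S N.+1] is [Phi (S N)], so contraction bounds the first difference and convergence of the
     iterates the second. *)
  have ->: Phi P - P = (Phi P - Phi (S N)) - (P - S N.+1).
    by rewrite opprB addrA subrK.
  apply: order_geB.
    do 2 apply: (order_geW (leqnSn _)).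
    exact: (contr _ _ _ gP (goodS _) (oPS _)).
  by do 2 apply: (order_geW (leqnSn _)).
exists P; have [oP vecP] := gP; split=> // i; apply: t_coefP => j.
have := PhiE P j i gP; rewrite PhiP /log_step_target.
rewrite (t_coefB (F i)) (t_coefB (act (exp_t P) _)) opprB addrCA.
have aux (V : zmodType) (x y z : V) : x = x + (y - z) -> z = y.
  by rewrite -{1}[x]addr0 => /addrI /esym /eqP; rewrite subr_eq0 => /eqP.
exact: aux.
Qed.

End Logarithm.

End VectorFields.

(** * Differentiation with respect to t *)

Section TimeDerivative.
Variables (K : comAlgType rat) (n : nat) (M : monomials n) (alpha : nat).
Local Notation Kz := (series M K).
Local Notation Ktz := (series M (tseries K)).
Local Notation ops := (diff_ops K M alpha).
Implicit Types (u v : Ktz) (P : tseries ops).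

Lemma t_coef_deriv_t u j : t_coef (deriv_t_coefs u) j = t_coef u j.+1 *+ j.+1.
Proof. by apply/seriesP => w; rewrite coefMn. Qed.

Lemma deriv_t_coefsD : {morph @deriv_t_coefs K n M : u v / u + v}.
Proof.
by move=> u v; apply: t_coefP => j; rewrite t_coefD !t_coef_deriv_t t_coefD mulrnDl.
Qed.

Lemma deriv_t_coefsB : {morph @deriv_t_coefs K n M : u v / u - v}.
Proof.
by move=> u v; apply: t_coefP => j; rewrite t_coefB !t_coef_deriv_t t_coefB mulrnBl.
Qed.

Lemma deriv_t_const (x : Kz) : deriv_t_coefs (const_t x) = 0.
Proof.
by apply: t_coefP => j; rewrite t_coef_deriv_t t_coef_const mul0rn t_coef0.
Qed.

Lemma deriv_t_t_var u : deriv_t_coefs (t_var *: u) = u + t_var *: deriv_t_coefs u.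
Proof.
apply: t_coefP => j; rewrite t_coefD t_coef_deriv_t !t_coef_t_varZ mulrS.
by case: j => [|j]; rewrite ?mulr0n // t_coef_deriv_t.
Qed.

Lemma deriv_t_coefsM u v :
  deriv_t_coefs (u * v) = deriv_t_coefs u * v + u * deriv_t_coefs v.
Proof.
apply/eqP; rewrite -subr_eq0; apply/eqP; move: u; apply: t_vanish.
- move=> u1 u2; rewrite mulrDl !deriv_t_coefsD !mulrDl.
  by rewrite (addrACA (deriv_t_coefs u1 * v)) opprD addrACA.
- move=> u; rewrite -!scalerAl !deriv_t_t_var mulrDl -!scalerAl
     -[X in _ - X]addrA -scalerDr.
  by rewrite opprD addrACA subrr add0r scalerBr.
move=> x; move: v; apply: t_vanish.
- move=> v1 v2; rewrite mulrDr !deriv_t_coefsD !mulrDr.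
  by rewrite (addrACA (deriv_t_coefs (const_t x) * v1)) opprD addrACA.
- move=> v; rewrite -!scalerAr !deriv_t_t_var mulrDr -!scalerAr [X in _ - X]addrCA -scalerDr.
  by rewrite opprD addrACA subrr add0r scalerBr.
by move=> y; rewrite -const_tM !deriv_t_const mul0r mulr0 addr0 subrr.
Qed.

Lemma order_ge_deriv_t k u : order_ge k u -> order_ge k (deriv_t_coefs u).
Proof.
move=> ou; apply: order_ge_t_coefs => j; rewrite t_coef_deriv_t => w lt_w.
by rewrite coefMn (order_ge_t_coef _ ou) ?mul0rn.
Qed.

(** Both sides behave alike under multiplication by t, and on a constant only the derivative of the
    coefficients of [P] remains. This makes [deriv_t g] the commutator [[d/dt, g]]. *)
Lemma act_deriv_t P u :
  act (deriv_t P) u = deriv_t_coefs (act P u) - act P (deriv_t_coefs u).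
Proof.
apply/eqP; rewrite eq_sym subr_eq -subr_eq0; apply/eqP; move: u; apply: t_vanish.
- move=> u v; rewrite deriv_t_coefsD !actD deriv_t_coefsD.
  by rewrite (addrACA (act (deriv_t P) u)) opprD addrACA.
- move=> u; rewrite deriv_t_t_var !actD !act_t_var deriv_t_t_var (addrCA (t_var *: _)).
  by rewrite opprD addrACA subrr add0r -scalerDr scalerBr.
move=> x; rewrite deriv_t_const act0 addr0; apply: t_coefP => j.
rewrite t_coefB t_coef0 t_coef_deriv_t !t_coef_act_const /=.
by rewrite opMnl subrr.
Qed.

End TimeDerivative.

Lemma leibniz_sub (R : nzRingType) (u v u1 v1 u2 v2 : R) :
  (u1 * v + u * v1) - (u2 * v + u * v2) = (u1 - u2) * v + u * (v1 - v2).
Proof. by rewrite opprD addrACA -mulrBl -mulrBr. Qed.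

Lemma at_minus_tK (K : comAlgType rat) (A : algType K) :
  involutive (@at_minus_t K A).
Proof.
move=> p; apply: (@seriesP _ powers_of_t) => m /=.
by rewrite mulrA -expr2 sqrr_sign mul1r.
Qed.

(** * The tuple of an automorphism and its equations *)

Section MainTheorem.
Variables (K : comAlgType rat) (n : nat) (M : monomials n) (alpha : nat).
Hypothesis multM : word_multiplicative M.
Hypothesis alpha_ge1 : (1 <= alpha)%N.
Local Notation Kz := (series M K).
Local Notation Ktz := (series M (tseries K)).
Local Notation ops := (diff_ops K M alpha).
Variable F : 'I_n -> Ktz.
Hypothesis F_auto : automorphism_A alpha F.
Implicit Types (G a : 'I_n -> Ktz) (P : tseries ops) (u : Ktz).

Lemma automorphism_order_ge1 i : order_ge 1 (F i).
Proof.
have [oH _ _] := F_auto; rewrite -(subKr (variable i) (F i)).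
by apply: order_geB; [apply: order_ge_variable | apply: order_geW alpha_ge1 (oH i)].
Qed.

Lemma subst_injective : injective (subst F).
Proof. by have [_ _ /bij_inj] := F_auto. Qed.

Lemma subst_inverse G u : inverse_map F G -> subst F (subst G u) = u.
Proof.
move=> [oG FG _]; rewrite (subst_comp multM _ automorphism_order_ge1 oG).
by rewrite (funext FG : (fun i => subst F (G i)) = variable) subst_id.
Qed.

Lemma subst_inverseV G u : inverse_map F G -> subst G (subst F u) = u.
Proof. by move=> invG; apply: subst_injective; rewrite subst_inverse. Qed.

(** Bijectivity only provides preimages of the variables; that they have no constant term must be
    derived before [subst G] can be handled as an algebra map. *)
Lemma inverse_map_exists : exists G, inverse_map F G.
Proof.
have [_ _ [Finv FinvK FK]] := F_auto; pose G i := Finv (variable i).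
have FG i : subst F (G i) = variable i by rewrite FK.
have oG i : order_ge 1 (G i).
  move=> w; rewrite ltnS leqn0 => /eqP w0.
  have w1 : w = mone by rewrite -(mword_prod w); move/size0nil: w0 => ->.
  (* [subst F] fixes scalars and preserves orders, so the constant term of [G i] equals that of
     [subst F (G i) = variable i], which is 0. *)
  have oSub : order_ge 1 (subst F (G i - coef (G i) mone *: 1)).
    apply: subst_order_ge => x; rewrite ltnS leqn0 => /eqP x0.
    have ->: x = mone by rewrite -(mword_prod x); move/size0nil: x0 => ->.
    by rewrite coefB coefZ coef1 eqxx mulr1 subrr.
  have := oSub w; rewrite w0 => /(_ isT); rewrite substB substZ subst1; last first.
    exact: automorphism_order_ge1.
  rewrite FG coefB (@order_ge_variable _ M _ i w) ?w0 // w1 coefZ coef1 eqxx mulr1.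
  by rewrite sub0r => /eqP; rewrite oppr_eq0 => /eqP.
exists G; split=> // i; apply: subst_injective.
rewrite (subst_comp multM _ automorphism_order_ge1 oG).
rewrite (funext FG : (fun i => subst F (G i)) = variable) subst_id // subst_variable //.
exact: automorphism_order_ge1.
Qed.

Lemma inverse_map_unique G G' : inverse_map F G -> inverse_map F G' -> G = G'.
Proof.
move=> [_ FG _] [_ FG' _]; apply/funext => i; apply: subst_injective.
by rewrite FG FG'.
Qed.

(** Because [G - z] is [z - F] evaluated at [G], and substitution does not lower orders. *)
Lemma inverse_order_ge G i : inverse_map F G -> order_ge alpha (G i - variable i).
Proof.
move=> [oG _ GF]; have [oH _ _] := F_auto.
rewrite -(GF i) -[X in X - _](subst_variable multM i oG) -substB.
exact: subst_order_ge (oH i).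
Qed.

(** The derivation in [D_Log] is an arbitrary map on [Ktz]; uniqueness of the derivation along [a]
    replaces it by the action of a series over [diff_ops]. *)
Lemma D_Log_vectorial a : D_Log alpha F a -> exists P,
  [/\ order_ge 1 P, vectorial P, derivation_along a (act P)
    & forall i, act (exp_t P) (variable i) = F i].
Proof.
move=> [a0 oa [D aD expD]]; have [P [vecP aP]] := vectorial_exists multM alpha_ge1 oa.
have oP : order_ge 1 P by apply: order_ge1_vectorial => // i; rewrite aP.2.
exists P; split=> // i; rewrite act_exp_t //.
by rewrite (derivation_along_unique aP aD).
Qed.

Lemma D_Log_exists : exists a, D_Log alpha F a.
Proof.
have [oH H0 _] := F_auto; have [P [oP vecP PF]] := log_exists multM alpha_ge1 oH H0.
exists (fun i => act P (variable i)); split=> [i|i|].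
- exact: t_coef_act_lt oP _.
- by apply: vectorial_order_ge => //; apply: order_ge_variable.
exists (act P) => [|i]; first exact: vectorial_along.
by rewrite -(act_exp_t _ oP).
Qed.

Lemma D_Log_unique a a' : D_Log alpha F a -> D_Log alpha F a' -> a = a'.
Proof.
move=> /D_Log_vectorial[P [oP vecP aP PF]] /D_Log_vectorial[Q [oQ vecQ aQ QF]].
have PQ : P = Q.
  exact: act_exp_t_inj oP oQ vecP vecQ (fun i => etrans (PF i) (esym (QF i))).
by apply/funext => i; rewrite -aP.2 -aQ.2 PQ.
Qed.

Lemma associated_tuple_exists :
  exists Omega : quintuple ops, associated_tuple F Omega.
Proof.
have [G invG] := inverse_map_exists; have [a logF] := D_Log_exists.
have [oG _ _] := invG; have [oH _ _] := F_auto.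
have [P [oP vecP aP PF]] := D_Log_vectorial logF.
have [h [_ hP]] : exists h : tseries ops, vectorial h /\
    derivation_along (fun i => subst F (deriv_t_coefs (G i - variable i))) (act h).
  apply: vectorial_exists => // i; apply/subst_order_ge/order_ge_deriv_t.
  exact: inverse_order_ge.
have [m [_ mP]] : exists m : tseries ops, vectorial m /\
    derivation_along (fun i => subst G (deriv_t_coefs (variable i - F i))) (act m).
  apply: vectorial_exists => // i; apply/subst_order_ge/order_ge_deriv_t.
  exact: oH.
have exp0 (Q : tseries ops) : order_ge 1 Q -> coef (exp_t Q) 0%N = 1.
  by move=> oQ; rewrite (coef_exp_t oQ (leqnn 0)) big_ord1 inv_fact0 scale1r.
have expF : act (exp_t P) =1 subst F.
  apply: act_exp_t_subst => //; first exact: vectorial_derivation.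
  exact: automorphism_order_ge1.
(* [act (- d)] has to be the derivation [act P] along [a], and [act (at_minus_t f)] has to be
   [subst F], that is [act (exp_t P)]; this dictates the signs. *)
exists (Quintuple (at_minus_t (exp_t P)) (exp_t (- P)) (- P) h m).
exists G, a; split.
- exact: conj invG logF.
- split; first exact: etrans (mul1r _) (exp0 _ oP).
  by move=> u; rewrite at_minus_tK; apply: expF.
- split; first exact/exp0/order_geN.
  (* Followed by the injective [subst F], both [act (exp_t (- P))] and [subst G] give the
     identity. *)
  move=> u; apply: subst_injective; apply: etrans (esym (subst_inverse u invG)).
  apply: etrans (esym (expF _)) _; rewrite -actM.
  by rewrite exp_t_mulN // act1.
- by rewrite opprK.
exact: conj hP mP.
Qed.

Lemma associated_tuple_unique (Omega Omega' : quintuple ops) :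
  associated_tuple F Omega -> associated_tuple F Omega' -> Omega = Omega'.
Proof.
case: Omega Omega' => [f g d h m] [f' g' d' h' m'].
move=> [G [a [[invG logF] [_ fP] [_ gP] dP [hP mP]]]].
move=> [G' [a' [[invG' logF'] [_ fP'] [_ gP'] dP' [hP' mP']]]].
have eqG := inverse_map_unique invG' invG; subst G'.
have eqa := D_Log_unique logF' logF; subst a'.
have -> : f = f'.
  apply: (can_inj (@at_minus_tK K ops)); apply: act_inj => u.
  exact: etrans (fP u) (esym (fP' u)).
have -> : g = g' by apply: act_inj => u; apply: etrans (gP u) (esym (gP' u)).
have -> : d = d' by apply: oppr_inj; apply: derivation_along_act_inj dP dP'.
have -> : h = h' by apply: derivation_along_act_inj hP hP'.
by have -> : m = m' by apply: derivation_along_act_inj mP mP'.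
Qed.

Lemma deriv_t_variable i : deriv_t_coefs (variable i) = 0 :> Ktz.
Proof. by rewrite -const_t_variable deriv_t_const. Qed.

(* With S = subst G and T = [d/dt, S], both S^-1 T and T S^-1 are derivations
   because S is multiplicative. *)
Lemma left_log_derivation_along G (D : Ktz -> Ktz) : inverse_map F G -> linear D ->
  D =1 (fun u => subst F (deriv_t_coefs (subst G u) - subst G (deriv_t_coefs u))) ->
  derivation_along (fun i => subst F (deriv_t_coefs (G i - variable i))) D.
Proof.
move=> invG linD DE; have [oG _ _] := invG; have oF := automorphism_order_ge1.
split; [split=> // u v|move=> i]; last first.
  rewrite DE subst_variable // deriv_t_coefsB deriv_t_variable.
  by rewrite !subst0.
rewrite !DE (substM multM u v oG) (deriv_t_coefsM (subst G u)) (deriv_t_coefsM u v).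
rewrite (substD G (deriv_t_coefs u * v)) (substM multM (deriv_t_coefs u) v oG).
rewrite (substM multM u (deriv_t_coefs v) oG) leibniz_sub.
rewrite (substD F (_ * subst G v)) (substM multM _ (subst G v) oF).
by rewrite (substM multM (subst G u) _ oF) !(subst_inverse _ invG).
Qed.

(** Here [T S^-1] appears with [S S^-1 = 1] already cancelled in its first term, which leaves a
    plain [d/dt]. *)
Lemma right_log_derivation_along G (D : Ktz -> Ktz) : inverse_map F G -> linear D ->
  D =1 (fun u => deriv_t_coefs u - subst G (deriv_t_coefs (subst F u))) ->
  derivation_along (fun i => subst G (deriv_t_coefs (variable i - F i))) D.
Proof.
move=> invG linD DE; have [oG _ _] := invG; have oF := automorphism_order_ge1.
split; [split=> // u v|move=> i]; last first.
  rewrite DE subst_variable // deriv_t_coefsB deriv_t_variable.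
  by rewrite !sub0r -scaleN1r -[in RHS]scaleN1r substZ.
rewrite !DE (substM multM u v oF) (deriv_t_coefsM (subst F u)) (deriv_t_coefsM u v).
rewrite (substD G (_ * subst F v)) (substM multM _ (subst F v) oG).
by rewrite (substM multM (subst F u) _ oG) !(subst_inverseV _ invG) leibniz_sub.
Qed.

Lemma associated_tuple_NCS (Omega : quintuple ops) :
  associated_tuple F Omega -> NCS_system Omega.
Proof.
case: Omega => f g d h m [G [a [[invG logF] [f0 fP] [g0 gP] dP [hP mP]]]].
have [oG _ GF] := invG; have oF := automorphism_order_ge1.
pose f' := at_minus_t f; rewrite /NCS_system -/f'.
have fg : f' * g = 1.
  apply: act_inj => u; rewrite actM act1.
  by apply: etrans (fP _) _; rewrite gP subst_inverse.
have gf : g * f' = 1.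
  apply: act_inj => u; rewrite actM act1.
  by apply: etrans (gP _) _; rewrite fP subst_inverseV.
have dgP u : act (deriv_t g) u = deriv_t_coefs (subst G u) - subst G (deriv_t_coefs u).
  by rewrite act_deriv_t !gP.
have [P [oP vecP aP PF]] := D_Log_vectorial logF.
have dE : - d = P by apply: derivation_along_act_inj dP aP.
have od : order_ge 1 d by rewrite -[d]opprK dE; apply: order_geN.
split=> //.
- split; first exact: order_ge_t_coef0 od _.
  (* Since [exp_t (- d)] is [f(-t)], both [exp_t d] and [g] are inverse to it and coincide. *)
  have expP : exp_t P = f'.
    apply: act_inj => u; apply: etrans (esym (fP u)).
    apply: act_exp_t_subst => //; exact: vectorial_derivation.
  by rewrite -[LHS]mulr1 -fg mulrA -expP -dE exp_t_mulN // mul1r.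
(* As [f(-t)] inverts [g], the equation amounts to [h = f(-t) g'], and this product acts as [S^-1
   [d/dt, S]], a derivation along the vector that defines [h]. *)
- have <- : f' * deriv_t g = h; last by rewrite mulrA gf mul1r.
  apply: derivation_along_act_inj hP; apply: (left_log_derivation_along invG).
    exact: act_linear.
  by move=> u; rewrite actM dgP; apply: fP.
(* Symmetrically, [g' f(-t)] acts as [[d/dt, S] S^-1]. *)
have <- : deriv_t g * f' = m; last by rewrite -mulrA fg mulr1.
apply: derivation_along_act_inj mP; apply: (right_log_derivation_along invG).
  exact: act_linear.
move=> u; rewrite actM dgP (fP u : act f' u = _).
by apply: (congr1 (fun x => deriv_t_coefs x - _)); apply: subst_inverseV.
Qed.

End MainTheorem.

(** The first conjunct shows that [F] determines its tuple, so the second is not vacuous. *)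
Theorem theorem3p14 (v : variables) (K : comAlgType rat) (n : nat)
    (n_ge1 : (1 <= n)%N) (alpha : nat) (alpha_ge1 : (1 <= alpha)%N)
    (F : 'I_n -> series (monomials_in v n) (tseries K))
    (F_auto : automorphism_A alpha F) :
  (exists! Omega : quintuple (diff_ops K (monomials_in v n) alpha),
     associated_tuple F Omega) /\
  (forall Omega : quintuple (diff_ops K (monomials_in v n) alpha),
     associated_tuple F Omega -> NCS_system Omega).
Proof.
have multM := monomials_in_word_multiplicative v n.
split; last exact: associated_tuple_NCS.
have [Omega OmegaP] := associated_tuple_exists multM alpha_ge1 F_auto.
exists Omega; split=> // Omega'; exact: associated_tuple_unique OmegaP.
Qed.
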